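(* Let $(R,\mathfrak m,k)$ be an equicharacteristic Cohen-Macaulay local ring of dimension $d\ge1$ with infinite residue field and let $I$ be an $\mathfrak m$-primary ideal. Assume $I^2\cap H=HI$ for some minimal reduction $H$ of $I$. Then $I$ is stretched if and only if $I$ is $j$-stretched.
   Context: $\lambda$ denotes length. An ideal $J\subseteq I$ is a reduction of $I$ if $I^{n+1}=JI^n$ for some $n\ge0$; it is minimal if minimal under inclusion. An $\mathfrak m$-primary ideal $I$ is stretched if there exists a minimal reduction $H$ of $I$ such that $H\cap I^2=HI$ and $\lambda\big(I^2/((H\cap I^2)+I^3)\big)\le1$ (this length is the value $HF_{I/H}(2)$ of the Hilbert function of $I/H$ on $R/H$). General elements: fix generators $I=(a_1,\dots,a_s)$. An assertion holds for general elements $x_1,\dots,x_t$ of $I$ if there is a Zariski dense open subset $U\subseteq k^{ts}$ such that it holds for all $x_i=\sum_{j}\lambda_{ij}a_j$ with $(\lambda_{ij})\in R^{ts}$ whose image in $k^{ts}$ lies in $U$. For $x_1,\dots,x_d$ general elements of $I$ let $J_{d-1}=(x_1,\dots,x_{d-1})$, $J_{d-1}:I^\infty=\{b\in R: bI^\delta\subseteq J_{d-1}\text{ for some }\delta>0\}$, $\overline R=R/(J_{d-1}:I^\infty)$, and let a bar denote images in $\overline R$. An ideal $I$ of analytic spread $d$ (in particular any $\mathfrak m$-primary ideal) is $j$-stretched if $\lambda\big(\overline I^2/(x_d\overline I+\overline I^3)\big)\le1$ for general $x_1,\dots,x_d$. *)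

(* Defs.v *)
From HB Require Import structures.
From mathcomp Require Import all_boot all_order all_algebra.
From mathcomp Require Import boolp classical_sets functions cardinality.
From mathcomp Require Import mpoly.

Set Implicit Arguments.
Unset Strict Implicit.
Unset Printing Implicit Defensive.

Import GRing.Theory.

Local Open Scope classical_set_scope.
Local Open Scope ring_scope.

Section Ideals.
Context {R : comPzRingType}.
Implicit Types (I J A B P m : set R).

(* The unit ideal is allowed, unlike in MathComp's [idealr]. *)
Definition is_ideal I : Prop :=
  [/\ I 0, forall x y, I x -> I y -> I (x + y) & forall a x, I x -> I (a * x)].

Definition ideal_gen A : set R := smallest is_ideal A.

Definition ideal_of_seq (xs : seq R) : set R := ideal_gen [set` xs].

Definition ideal_add I J : set R := [set x + y | x in I & y in J].

Definition ideal_mul I J : set R := ideal_gen [set x * y | x in I & y in J].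

Definition ideal_exp I (n : nat) : set R := iter n (ideal_mul I) setT.

Definition saturation J I : set R :=
  [set b | exists2 n, (0 < n)%N & forall y, ideal_exp I n y -> J (b * y)].

Definition ideal_radical I : set R := [set x | exists n, I (x ^+ n)].

Definition prime_ideal P : Prop :=
  [/\ is_ideal P, ~ P 1 & forall x y, P (x * y) -> P x \/ P y].

Definition maximal_ideal m : Prop :=
  [/\ is_ideal m, ~ m 1 & forall J, is_ideal J -> ~ J 1 -> m `<=` J -> J = m].

Definition primary_ideal I : Prop :=
  [/\ is_ideal I, ~ I 1 &
      forall x y, I (x * y) -> I x \/ ideal_radical I y].

Definition primary_to m I : Prop := primary_ideal I /\ ideal_radical I = m.

(* The length of A/B is at most n, for ideals B `<=` A: submodules of A/B
   correspond to the ideals between B and A, so length is the supremum of the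
   lengths l of the strict chains N 0 `<` ... `<` N l of such ideals. *)
Definition quot_length_le A B (n : nat) : Prop :=
  forall (N : nat -> set R) (l : nat),
    (forall i, (i <= l)%N -> [/\ is_ideal (N i), B `<=` N i & N i `<=` A]) ->
    (forall i, (i < l)%N -> N i `<` N i.+1) ->
    (l <= n)%N.

Definition is_reduction J I : Prop :=
  [/\ is_ideal J, J `<=` I &
      exists n, ideal_exp I n.+1 = ideal_mul J (ideal_exp I n)].

Definition minimal_reduction J I : Prop :=
  is_reduction J I /\ forall J', is_reduction J' I -> J' `<=` J -> J' = J.

Definition stretched I : Prop :=
  exists H, [/\ minimal_reduction H I,
                H `&` ideal_exp I 2 = ideal_mul H I &
                quot_length_le (ideal_exp I 2)
                  (ideal_add (H `&` ideal_exp I 2) (ideal_exp I 3)) 1].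

Definition regular_sequence (xs : seq R) : Prop :=
  ~ ideal_of_seq xs 1 /\
  forall i, (i < size xs)%N -> forall b,
    ideal_of_seq (take i xs) (xs`_i * b) -> ideal_of_seq (take i xs) b.

Definition has_depth m (n : nat) : Prop :=
  (exists xs, [/\ regular_sequence xs, [set` xs] `<=` m & size xs = n]) /\
  (forall xs, regular_sequence xs -> [set` xs] `<=` m -> (size xs <= n)%N).

Lemma ideal_gen_ideal A : is_ideal (ideal_gen A).
Proof.
split=> [I [[] //]|x y Ax Ay I AI|a x Ax I AI]; case: (AI) => -[_ ID IM] _.
- by apply: ID; [apply: Ax|apply: Ay].
- by apply: IM; apply: Ax.
Qed.

End Ideals.

Definition prime_chain (R : comPzRingType) (n : nat) (P : nat -> set R) : Prop :=
  (forall i, (i <= n)%N -> prime_ideal (P i)) /\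
  (forall i, (i < n)%N -> P i `<` P i.+1).

Definition has_krull_dim (R : comPzRingType) (n : nat) : Prop :=
  (exists P : nat -> set R, prime_chain n P) /\
  (forall l (P : nat -> set R), prime_chain l P -> (l <= n)%N).

Definition noetherian (R : comPzRingType) : Prop :=
  forall I : set R, is_ideal I -> exists xs : seq R, I = ideal_of_seq xs.

Definition is_local (R : comPzRingType) (m : set R) : Prop :=
  maximal_ideal m /\ forall m' : set R, maximal_ideal m' -> m' = m.

Definition cohen_macaulay_local (R : comPzRingType) (m : set R) : Prop :=
  [/\ noetherian R, is_local m & exists n, has_krull_dim R n /\ has_depth m n].

(* [res] exhibits k as the residue field R/m. *)
Definition is_residue_map (R : comNzRingType) (m : set R) (k : fieldType)
    (res : {rmorphism R -> k}) : Prop :=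
  (forall y, exists x, res x = y) /\ (forall x, res x = 0 <-> m x).

(* R and k have the same characteristic: Z -> R and Z -> k have the same
   kernel.  MathComp's [pchar] does not see a characteristic p^n with n > 1. *)
Definition equicharacteristic (R k : nzRingType) : Prop :=
  forall n : nat, n%:R = 0 :> R <-> n%:R = 0 :> k.

Section QuotientRing.
Variables (R : comNzRingType) (A : set R).

Definition ideal_mem : R -> bool := fun x => `[< ideal_gen A x >].

Fact ideal_mem_zmod_closed : zmod_closed ideal_mem.
Proof.
have [g0 gD gM] := ideal_gen_ideal A.
split; first exact/asboolP.
move=> x y /asboolP gx /asboolP gy; apply/asboolP.
by have := gD _ _ gx (gM (-1) _ gy); rewrite mulN1r.
Qed.

HB.instance Definition _ :=
  GRing.isZmodClosed.Build R ideal_mem ideal_mem_zmod_closed.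

Definition ideal_zmod : zmodClosed R := GRing.ZmodClosed.clone R ideal_mem _.

(* The ring R/(A).  MathComp makes the quotient of R by an ideal a ring only
   for proper ideals; here (A) is arbitrary and the zero ring may occur. *)
Definition quot_ring : Type := Quotient.quot ideal_zmod.

HB.instance Definition _ := GRing.Zmodule.on quot_ring.

Definition quot_map : R -> quot_ring :=
  fun x => (\pi_(Quotient.quot ideal_zmod) x)%qT.

Lemma quot_mapP x y : quot_map x = quot_map y <-> ideal_gen A (x - y).
Proof.
split=> [/eqP|g]; first by rewrite -Quotient.idealrBE => /asboolP.
by apply/eqP; rewrite -Quotient.idealrBE; apply/asboolP.
Qed.

Lemma quot_map_surj y : exists x, quot_map x = y.
Proof. by exists (repr y); rewrite /quot_map reprK. Qed.

Definition quot_one : quot_ring := quot_map 1.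
Definition quot_mul (x y : quot_ring) : quot_ring :=
  quot_map (repr x * repr y).

Lemma quot_mapM x y : quot_map (x * y) = quot_mul (quot_map x) (quot_map y).
Proof.
have [_ gD gM] := ideal_gen_ideal A.
have hr z : ideal_gen A (z - repr (quot_map z)).
  by apply/quot_mapP; rewrite /quot_map reprK.
apply/quot_mapP; set x' := repr _; set y' := repr _.
have -> : x * y - x' * y' = x * (y - y') + y' * (x - x').
  by rewrite !mulrBr [y' * x]mulrC [y' * x']mulrC addrA subrK.
by apply: gD; apply: gM; apply: hr.
Qed.

Fact quot_mulA : associative quot_mul.
Proof.
move=> x y z; have [[[a <-] [b <-]] [c <-]] :=
  (quot_map_surj x, quot_map_surj y, quot_map_surj z).
by rewrite -!quot_mapM mulrA.
Qed.

Fact quot_mulC : commutative quot_mul.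
Proof. by move=> x y; rewrite /quot_mul mulrC. Qed.

Fact quot_mul1 : left_id quot_one quot_mul.
Proof.
by move=> x; have [a <-] := quot_map_surj x; rewrite -quot_mapM mul1r.
Qed.

Fact quot_map_is_zmod_morphism : zmod_morphism quot_map.
Proof. by move=> x y; rewrite /quot_map raddfB. Qed.

HB.instance Definition _ :=
  GRing.isZmodMorphism.Build R quot_ring quot_map quot_map_is_zmod_morphism.

Fact quot_mulDl : left_distributive quot_mul +%R.
Proof.
move=> x y z; have [[[a <-] [b <-]] [c <-]] :=
  (quot_map_surj x, quot_map_surj y, quot_map_surj z).
by rewrite -raddfD -!quot_mapM mulrDl raddfD.
Qed.

HB.instance Definition _ := GRing.Zmodule_isComPzRing.Build quot_ring
  quot_mulA quot_mulC quot_mul1 quot_mulDl.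

Fact quot_map_is_monoid_morphism : monoid_morphism quot_map.
Proof. by split=> // x y; rewrite quot_mapM. Qed.

HB.instance Definition _ := GRing.isMonoidMorphism.Build R quot_ring quot_map
  quot_map_is_monoid_morphism.

End QuotientRing.

Arguments quot_map {R} A x.

Section Zariski.
Variables (k : fieldType) (t s : nat).
Implicit Types (U V Z : set 'M[k]_(t, s)).

Definition zariski_closed Z : Prop :=
  exists F : set {mpoly k[t * s]},
    Z = [set M | forall p, F p -> p.@[fun l => mxvec M 0 l] = 0].

Definition zariski_open U : Prop := zariski_closed (~` U).

Definition zariski_dense U : Prop :=
  forall V, zariski_open V -> V !=set0 -> (U `&` V) !=set0.

End Zariski.

(* [P] holds for t general elements of the ideal generated by [a]. *)
Definition for_general (R : comNzRingType) (k : fieldType)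
    (res : {rmorphism R -> k}) (s : nat) (a : s.-tuple R) (t : nat)
    (P : t.-tuple R -> Prop) : Prop :=
  exists U : set 'M[k]_(t, s),
    [/\ zariski_open U, zariski_dense U &
        forall L : 'M[R]_(t, s), U (map_mx res L) ->
          P [tuple \sum_(j < s) L i j * tnth a j | i < t]].

(* d is the analytic spread of I, and [a] generates I.  The elements
   x_1, ..., x_d are indexed from 0, so that x_d is [x`_d.-1]. *)
Definition j_stretched (R : comNzRingType) (k : fieldType)
    (res : {rmorphism R -> k}) (d : nat) (I : set R) (s : nat)
    (a : s.-tuple R) : Prop :=
  for_general res a (fun x : d.-tuple R =>
    let K := saturation (ideal_of_seq (take d.-1 x)) I in
    let Ibar : set (quot_ring K) := quot_map K @` I in
    let xbar : quot_ring K := quot_map K x`_d.-1 in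
    quot_length_le (ideal_exp Ibar 2)
      (ideal_add (ideal_mul (ideal_of_seq [:: xbar]) Ibar) (ideal_exp Ibar 3))
      1).

(* Main.v *)
(** Write J(L) for the ideal generated by the combinations x_i(L) of the given
    generators of I with coefficient matrix L.  The genericity statements rest
    on one device: if I B = J(L0) B + C + (w), then Cramer's rule over the
    polynomial ring R[T], applied to a matrix equal to 1 at T = L0, expresses
    the products x_i(L0) b through J(L) B + C and w as soon as a polynomial
    whose value at L0 is 1 takes a unit value at L.  As polynomials over R are
    involved, and not over k, this controls all liftings of a residue matrix at
    once; in particular it is an open condition on the residues that
    I^2/(J(L) I + I^3) has length at most 1, or that J(L) is a reduction of I.

    Minimal reductions are generated by d elements: more generators satisfy a
    homogeneous relation with a unit coefficient modulo m, because the length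
    of R/I^n grows at most like n^d, and the relation allows one to drop a
    generator.  In a Cohen-Macaulay ring d generators of an m-primary ideal form
    a regular sequence.  Hence H cap I^2 = HI says that the generators of H are
    independent in I/I^2 over R/I, an open condition too (test it on the socle
    of R/I), so that J cap I^2 = JI for generic J.  Finally x_d is regular
    modulo J_{d-1}, whence J_{d-1} : I^infty = J_{d-1}, and the length in the
    definition of j-stretched is that of I^2/(JI + I^3). *)

Require Import Defs.
From HB Require Import structures.
From mathcomp Require Import all_boot all_order all_algebra.
From mathcomp Require Import boolp classical_sets functions cardinality.
From mathcomp Require Import finmap mpoly ring.

Set Implicit Arguments.
Unset Strict Implicit.
Unset Printing Implicit Defensive.

Import GRing.Theory.

Local Open Scope classical_set_scope.
Local Open Scope ring_scope.

(** * Polynomials over an infinite field *)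

(** The length of I^2/(J(L) I + I^3) is taken over the Artinian ring R/I, so bounding it is not a
    rank condition over k, and matrices L with the same residues may give different ideals. It is
    therefore restated with a fixed generator w of the quotient that is killed by m, which leaves
    finitely many memberships to carry from L0 to L. Independence in I/I^2 does become a rank
    condition over k, once the coefficients are taken in the socle of R/I. The two directions are
    asymmetric. A stretched ideal supplies one special matrix L0, from which the length bound must
    be spread to generic L. A j-stretched ideal supplies the bound at generic L but says nothing
    about J(L) cap I^2; this comes from the reduction given in the hypothesis. Dimension theory is
    reached through a regular sequence [zs] of length d in m: prime chains show that it generates an
    m-primary ideal, and numbers of generators are then compared with [size zs]. *)

Lemma base_expansion_inj (B n : nat) (f g : 'I_n -> nat) :
  (forall i, f i < B)%N -> (forall i, g i < B)%N ->
  (\sum_(i < n) f i * B ^ i = \sum_(i < n) g i * B ^ i)%N -> f =1 g.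
Proof.
elim: n f g => [|n IHn] f g fB gB; first by move=> _ [].
have shift (h : 'I_n.+1 -> nat) :
  (\sum_(i < n.+1) h i * B ^ i
   = h ord0 + (\sum_(i < n) h (lift ord0 i) * B ^ i) * B)%N.
  rewrite big_ord_recl /= expn0 muln1 big_distrl /=; congr addn.
  by apply: eq_bigr => i _; rewrite expnSr mulnA.
rewrite !shift => eq_fg.
have B0 : (0 < B)%N by exact: leq_ltn_trans (fB ord0).
have e0 : f ord0 = g ord0.
  by have := congr1 (modn^~ B) eq_fg; rewrite ![(_ + _ * B)%N]addnC !modnMDl !modn_small.
have eS := IHn (f \o lift ord0) (g \o lift ord0) (fun i => fB _) (fun i => gB _).
move=> i; case: (unliftP ord0 i) => [j|] -> //.
apply: eS => /=; apply/eqP; rewrite -(eqn_pmul2r B0); apply/eqP.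
by move: eq_fg; rewrite e0 => /addnI.
Qed.

Section Nonvanishing.
Variables (k : fieldType) (k_infinite : infinite_set [set: k]).

Lemma poly_nonroot (p : {poly k}) : p != 0 -> exists t, p.[t] != 0.
Proof.
move=> p0; apply/not_existsP => p_root.
have [B _ sizeB] := infinite_set_fset (size p) k_infinite.
have Broot : all (root p) (B : seq k).
  apply/allP => t _; apply/rootP/eqP.
  by have /negP := p_root t; rewrite negbK.
by have := max_poly_roots p0 Broot (fset_uniq B); rewrite ltnNge sizeB.
Qed.

(* Kronecker's substitution [X_i := t ^ (B ^ i)], for [B] larger than all
   exponents, keeps distinct monomials distinct. *)
Lemma mpoly_nonvanishing n (p : {mpoly k[n]}) :
  p != 0 -> exists v : 'I_n -> k, p.@[v] != 0.
Proof.
move=> p0; pose B := msize p; pose w (u : 'X_{1..n}) := (\sum_(i < n) u i * B ^ i)%N.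
have uB u : u \in msupp p -> forall i, (u i < B)%N.
  move=> /msize_mdeg_lt lt_u i; apply: leq_ltn_trans lt_u.
  by rewrite mdegE (bigD1 i) //= leq_addr.
pose q : {poly k} := \sum_(u <- msupp p) p@_u *: 'X^(w u).
have /poly_nonroot[t qt] : q != 0.
  have: mlead p \in msupp p by exact: mlead_supp.
  set u0 := mlead p => u0p; apply/eqP => /(congr1 (fun r : {poly k} => r`_(w u0))).
  rewrite coef0 coef_sum (bigD1_seq u0) ?msupp_uniq //= coefZ coefXn eqxx mulr1.
  rewrite big_seq_cond big1 ?addr0.
    by move/eqP; rewrite mcoeff_eq0 u0p.
  move=> u /andP[up uu0]; rewrite coefZ coefXn; case: eqP; rewrite ?mulr0 // => ww.
  by case/eqP: uu0; apply/mnmP; apply: base_expansion_inj (esym ww) => i; exact: uB.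
exists (fun i => t ^+ (B ^ i)); rewrite mevalE.
rewrite (_ : \sum_(u <- _) _ = q.[t]) // horner_sum; apply: eq_bigr => u _.
rewrite hornerZ hornerXn; congr (_ * _); rewrite /w.
rewrite -prodrXr; apply: eq_bigr => i _.
by rewrite mulnC exprM.
Qed.

End Nonvanishing.

(** A matrix of largest rank with row space inside [Z] works, since a missing vector of [Z] could be
    adjoined and would raise the rank. Membership in a subspace given by a predicate thus becomes a
    matrix equation through [cokermx]. *)
Lemma subspace_matrix (k : fieldType) n (Z : 'rV[k]_n -> Prop) :
  Z 0 -> (forall u v, Z u -> Z v -> Z (u + v)) -> (forall c u, Z u -> Z (c *: u)) ->
  exists A : 'M[k]_n, forall v, Z v <-> (v <= A)%MS.
Proof.
move=> Z0 ZD ZZ.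
pose Pr r := `[< exists2 A : 'M[k]_n, \rank A = r & forall v, (v <= A)%MS -> Z v >].
have Pr0 : exists r, Pr r.
  exists 0%N; apply/asboolP; exists 0; first exact: mxrank0.
  by move=> v; rewrite submx0 => /eqP ->.
have Prn r : Pr r -> (r <= n)%N by move=> /asboolP[A <- _]; exact: rank_leq_row.
case: (ex_maxnP Pr0 Prn) => r /asboolP[A rA ZA] maxr.
exists A => v; split=> [Zv|]; last exact: ZA.
apply: contrapT => /negP vA.
have ltA : (A < A + v)%MS.
  by rewrite /ltmx addsmxSl addsmx_sub submx_refl.
have : (\rank (A + v)%MS <= r)%N.
  apply: maxr; apply/asboolP; exists (A + v)%MS => // u /sub_addsmxP[[x y] /= ->].
  apply: ZD; first by apply: ZA; exact: submxMl.
  have -> : y *m v = y 0 0 *: v by rewrite -mul_scalar_mx -mx11_scalar.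
  exact: ZZ.
by rewrite leqNgt -rA rank_ltmx.
Qed.

(** * Ideals *)

Section IdealCalculus.
Variable R : comPzRingType.
Implicit Types (A B C I J : set R) (x y r : R).

Lemma ideal0 I : is_ideal I -> I 0. Proof. by case. Qed.

Lemma idealD x y I : I x -> I y -> is_ideal I -> I (x + y).
Proof. by move=> Ix Iy [_ + _]; exact. Qed.

Lemma idealMl r x I : I x -> is_ideal I -> I (r * x).
Proof. by move=> Ix [_ _]; exact. Qed.

Lemma idealMr r x I : I x -> is_ideal I -> I (x * r).
Proof. by rewrite mulrC; exact: idealMl. Qed.

Lemma idealN x I : I x -> is_ideal I -> I (- x).
Proof. by move=> idI Ix; rewrite -mulN1r; exact: idealMl. Qed.

Lemma idealB x y I : I x -> I y -> is_ideal I -> I (x - y).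
Proof. by move=> Ix Iy idI; apply: idealD => //; exact: idealN. Qed.

Lemma idealBr y x I : I (x - y) -> I y -> is_ideal I -> I x.
Proof. by move=> Ixy Iy idI; rewrite -(subrK y x); exact: idealD. Qed.

Lemma ideal_bigsum (T : Type) (s : seq T) (P : pred T) (F : T -> R) I :
  (forall i, P i -> I (F i)) -> is_ideal I -> I (\sum_(i <- s | P i) F i).
Proof.
by move=> IF idI; apply: big_ind => //; [exact: ideal0|move=> *; exact: idealD].
Qed.

Lemma ideal_gen_min A J : is_ideal J -> A `<=` J -> ideal_gen A `<=` J.
Proof. by move=> idJ AJ; apply: smallest_sub. Qed.

Lemma sub_ideal_gen A : A `<=` ideal_gen A.
Proof. exact: sub_gen_smallest. Qed.

Lemma ideal_gen_id I : is_ideal I -> ideal_gen I = I.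
Proof. by move=> idI; rewrite /ideal_gen smallest_id. Qed.

Lemma ideal_seq_ideal (xs : seq R) : is_ideal (ideal_of_seq xs).
Proof. exact: ideal_gen_ideal. Qed.
#[local] Hint Resolve ideal_seq_ideal : core.

Lemma mem_ideal_seq (xs : seq R) x : x \in xs -> ideal_of_seq xs x.
Proof. by move=> xxs; apply: sub_ideal_gen. Qed.

Lemma ideal_seq_min (xs : seq R) J :
  is_ideal J -> (forall x, x \in xs -> J x) -> ideal_of_seq xs `<=` J.
Proof. by move=> idJ xJ; apply: ideal_gen_min => // x; exact: xJ. Qed.

Lemma ideal_seq_sub (xs ys : seq R) :
  {subset xs <= ys} -> ideal_of_seq xs `<=` ideal_of_seq ys.
Proof.
by move=> sub; apply: ideal_seq_min => // x xxs; apply: mem_ideal_seq; exact: sub.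
Qed.

Lemma ideal_seq_eq_mem (xs ys : seq R) :
  xs =i ys -> ideal_of_seq xs = ideal_of_seq ys.
Proof.
by move=> e; rewrite eqEsubset; split; apply: ideal_seq_sub => x; rewrite e.
Qed.

Lemma ideal_seq_nil : ideal_of_seq [::] = [set 0 : R].
Proof.
rewrite eqEsubset; split; last by move=> _ ->; exact: ideal0.
apply: ideal_seq_min => //; split=> // [x y -> ->|x y ->]; first by rewrite /= addr0.
by rewrite /= mulr0.
Qed.

Lemma ideal_seq_consP y (p : seq R) x :
  ideal_of_seq (y :: p) x <-> exists r, ideal_of_seq p (x - r * y).
Proof.
split=> [|[r px]]; last first.
  apply: (@idealBr (r * y)) => //; last first.
    by apply: idealMl => //; apply: mem_ideal_seq; rewrite mem_head.
  by move: px; apply: ideal_seq_sub => z; rewrite inE orbC => ->.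
apply: (@ideal_seq_min _ [set x | exists r, ideal_of_seq p (x - r * y)]) => /=.
  split=> [|u v [r ur] [t vt]|t u [r ur]].
  - by exists 0; rewrite mul0r subr0; exact: ideal0.
  - exists (r + t); rewrite mulrDl opprD addrACA; exact: idealD.
  - by exists (t * r); rewrite -mulrA -mulrBr; exact: idealMl.
move=> z; rewrite inE => /orP[/eqP ->|zp].
  by exists 1; rewrite mul1r subrr; exact: ideal0.
by exists 0; rewrite mul0r subr0; exact: mem_ideal_seq.
Qed.

Lemma ideal_seq_head y (p : seq R) : ideal_of_seq (y :: p) y.
Proof. by apply: mem_ideal_seq; rewrite mem_head. Qed.

Lemma ideal_seq_behead y (p : seq R) :
  ideal_of_seq p `<=` ideal_of_seq (y :: p).
Proof. by apply: ideal_seq_sub => z; rewrite inE orbC => ->. Qed.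

Lemma ideal_seq_cons_min y (p : seq R) J :
  is_ideal J -> J y -> ideal_of_seq p `<=` J -> ideal_of_seq (y :: p) `<=` J.
Proof.
move=> idJ Jy pJ x /ideal_seq_consP[r /pJ].
by move/idealBr; apply => //; exact: idealMl.
Qed.

(** Indexing by a finite type makes coefficients plain functions and lets pairs index the products
    of two families. *)
Definition ispan (T : finType) (h : T -> R) : set R := ideal_of_seq (codom h).

Lemma ispan_ideal (T : finType) (h : T -> R) : is_ideal (ispan h).
Proof. exact: ideal_seq_ideal. Qed.

Lemma ispan_mem (T : finType) (h : T -> R) i : ispan h (h i).
Proof. by apply: mem_ideal_seq; exact: codom_f. Qed.

Lemma ispan_min (T : finType) (h : T -> R) J :
  is_ideal J -> (forall i, J (h i)) -> ispan h `<=` J.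
Proof. by move=> idJ hJ; apply: ideal_seq_min => // _ /codomP[i ->]. Qed.

Lemma ispanP (T : finType) (h : T -> R) x :
  ispan h x <-> exists r : T -> R, x = \sum_i r i * h i.
Proof.
split=> [|[r ->]]; last first.
  apply: ideal_bigsum => [i _|]; last exact: ispan_ideal.
  by apply: idealMl; [exact: ispan_mem|exact: ispan_ideal].
apply: (@ispan_min _ _ [set x | exists r : T -> R, x = \sum_i r i * h i]) => /=.
  split=> [|_ _ [r ->] [t ->]|t _ [r ->]].
  - by exists (fun=> 0); rewrite big1 // => i _; rewrite mul0r.
  - exists (fun i => r i + t i); rewrite -big_split /=.
    by apply: eq_bigr => i _; rewrite mulrDl.
  - exists (fun i => t * r i); rewrite big_distrr /=.
    by apply: eq_bigr => i _; rewrite mulrA.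
move=> i; exists (fun j => (j == i)%:R).
by rewrite (bigD1 i) //= eqxx mul1r big1 ?addr0 // => j /negPf ->; rewrite mul0r.
Qed.

Lemma ispan_nth (xs : seq R) :
  ideal_of_seq xs = ispan (fun i : 'I_(size xs) => xs`_i).
Proof.
apply: ideal_seq_eq_mem => x; apply/idP/codomP => [xxs|[i ->]].
  have xi : (index x xs < size xs)%N by rewrite index_mem.
  by exists (Ordinal xi); rewrite /= nth_index.
exact: mem_nth.
Qed.

Lemma ispan_tuple n (xs : n.-tuple R) : ideal_of_seq xs = ispan (tnth xs).
Proof. by rewrite /ispan codomE map_tnth_enum. Qed.

Lemma ispan_mktuple n (h : 'I_n -> R) : ideal_of_seq (mktuple h) = ispan h.
Proof. by rewrite ispan_tuple; congr ispan; apply/funext => i; rewrite tnth_mktuple. Qed.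

Lemma ideal_mul_ideal I J : is_ideal (ideal_mul I J).
Proof. exact: ideal_gen_ideal. Qed.
Hint Resolve ideal_mul_ideal : core.

Lemma mem_ideal_mul I J x y : I x -> J y -> ideal_mul I J (x * y).
Proof. by move=> Ix Jy; apply: sub_ideal_gen; exists x => //; exists y. Qed.

Lemma ideal_mul_min I J C :
  is_ideal C -> (forall x y, I x -> J y -> C (x * y)) -> ideal_mul I J `<=` C.
Proof. by move=> idC H; apply: ideal_gen_min => // _ [x Ix [y Jy <-]]; exact: H. Qed.

Lemma ideal_mulS I I' J J' :
  I `<=` I' -> J `<=` J' -> ideal_mul I J `<=` ideal_mul I' J'.
Proof.
move=> II JJ; apply: ideal_mul_min => // x y Ix Jy.
by apply: mem_ideal_mul; [exact: II|exact: JJ].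
Qed.

Lemma ideal_mulC I J : ideal_mul I J = ideal_mul J I.
Proof.
by rewrite eqEsubset; split; apply: ideal_mul_min => // x y ? ?; rewrite mulrC;
  apply: mem_ideal_mul.
Qed.

Lemma ideal_mul_subr I J : is_ideal J -> ideal_mul I J `<=` J.
Proof. by move=> idJ; apply: ideal_mul_min => // x y _ Jy; exact: idealMl. Qed.

Lemma ideal_mul_subl I J : is_ideal I -> ideal_mul I J `<=` I.
Proof. by rewrite ideal_mulC; exact: ideal_mul_subr. Qed.

Lemma ispan_mulP (T : finType) (h : T -> R) B x : is_ideal B ->
  ideal_mul (ispan h) B x <->
  exists b : T -> R, (forall i, B (b i)) /\ x = \sum_i h i * b i.
Proof.
move=> idB; split=> [|[b [Bb ->]]]; last first.
  apply: ideal_bigsum => // i _.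
  by apply: mem_ideal_mul => //; exact: ispan_mem.
move: x; apply: ideal_mul_min.
  split=> [|_ _ [b [Bb ->]] [c [Bc ->]]|t _ [b [Bb ->]]].
  - by exists (fun=> 0); split=> [i|]; [exact: ideal0|rewrite big1 // => i; rewrite mulr0].
  - exists (fun i => b i + c i); split=> [i|]; first exact: idealD.
    by rewrite -big_split /=; apply: eq_bigr => i _; rewrite mulrDr.
  - exists (fun i => t * b i); split=> [i|]; first exact: idealMl.
    by rewrite big_distrr /=; apply: eq_bigr => i _; rewrite mulrCA.
move=> _ y /ispanP[r ->] By; exists (fun i => r i * y).
split=> [i|]; first exact: idealMl.
by rewrite big_distrl /=; apply: eq_bigr => i _; rewrite [RHS]mulrCA mulrA.
Qed.

Lemma ispan_mul_ispan (T U : finType) (h : T -> R) (g : U -> R) :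
  ideal_mul (ispan h) (ispan g) = ispan (fun tu : T * U => h tu.1 * g tu.2).
Proof.
rewrite eqEsubset; split; last first.
  by apply: ispan_min => // -[t u] /=; apply: mem_ideal_mul; exact: ispan_mem.
apply: ideal_mul_min => [|_ _ /ispanP[r ->] /ispanP[c ->]]; first exact: ispan_ideal.
rewrite big_distrlr /=; apply: ideal_bigsum => [t _|]; last exact: ispan_ideal.
apply: ideal_bigsum => [u _|]; last exact: ispan_ideal.
rewrite mulrACA; apply: (@idealMl (r t * c u) (h t * g u)); last exact: ispan_ideal.
exact: (@ispan_mem _ (fun tu : T * U => h tu.1 * g tu.2) (t, u)).
Qed.

Lemma ispan_enum_val (T : finType) (h : T -> R) :
  ispan (fun l : 'I_#|T| => h (enum_val l)) = ispan h.
Proof.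
rewrite eqEsubset; split; apply: ispan_min => [|t]; try exact: ispan_ideal.
  exact: ispan_mem.
rewrite -(enum_rankK t); exact: (@ispan_mem _ (fun l => h (enum_val l)) (enum_rank t)).
Qed.

Lemma ideal_exp_ideal I n : is_ideal (ideal_exp I n).
Proof. by case: n => [|n] //=; exact: ideal_mul_ideal. Qed.
Hint Resolve ideal_exp_ideal : core.

Lemma ideal_expS I n : ideal_exp I n.+1 = ideal_mul I (ideal_exp I n).
Proof. by []. Qed.

Lemma ideal_exp1 I : is_ideal I -> ideal_exp I 1 = I.
Proof.
move=> idI; rewrite ideal_expS eqEsubset; split; first exact: ideal_mul_subl.
by move=> x Ix; rewrite -(mulr1 x); apply: mem_ideal_mul.
Qed.

Lemma ideal_expD_mem I n n' x y :
  ideal_exp I n x -> ideal_exp I n' y -> ideal_exp I (n + n') (x * y).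
Proof.
elim: n x y => [|n IHn] x y; first by move=> _ Iy; exact: idealMl.
rewrite addSn !ideal_expS => Ix Iy.
have idC : is_ideal [set x | ideal_mul I (ideal_exp I (n + n')) (x * y)].
  split=> /= [|u v Iu Iv|r u Iu].
  - by rewrite mul0r; exact: ideal0.
  - by rewrite mulrDl; exact: idealD.
  - by rewrite -mulrA; exact: idealMl.
apply: (ideal_mul_min idC) Ix => u v Iu Iv /=; rewrite -mulrA.
by apply: mem_ideal_mul (IHn _ _ Iv Iy).
Qed.

Lemma ideal_exp_le I n n' : (n <= n')%N -> ideal_exp I n' `<=` ideal_exp I n.
Proof.
elim: n' => [|n' IHn']; first by rewrite leqn0 => /eqP ->.
rewrite leq_eqVlt ltnS => /predU1P[-> //|/IHn' sub].
by apply: (subset_trans _ sub); rewrite ideal_expS; exact: ideal_mul_subr.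
Qed.

Lemma ideal_expX I n x : I x -> ideal_exp I n (x ^+ n).
Proof. by move=> Ix; elim: n => [|n IHn] //; rewrite exprS; apply: mem_ideal_mul. Qed.

Lemma ideal_exp_prod I (T : finType) (F : T -> R) (e : T -> nat) :
  (forall i, I (F i)) -> ideal_exp I (\sum_i e i) (\prod_i F i ^+ e i).
Proof.
move=> IF; elim/big_rec2: _ => // i x n _ Ix.
by apply: ideal_expD_mem => //; exact: ideal_expX.
Qed.

Lemma ideal_add_ideal I J : is_ideal I -> is_ideal J -> is_ideal (ideal_add I J).
Proof.
move=> idI idJ; split.
- by exists 0; [exact: ideal0|exists 0; [exact: ideal0|rewrite addr0]].
- move=> _ _ [x Ix [y Jy <-]] [u Iu [v Jv <-]].
  exists (x + u); first exact: idealD.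
  by exists (y + v); [exact: idealD|rewrite addrACA].
- move=> r _ [x Ix [y Jy <-]]; exists (r * x); first exact: idealMl.
  by exists (r * y); [exact: idealMl|rewrite mulrDr].
Qed.

Lemma sub_ideal_addl I J : is_ideal J -> I `<=` ideal_add I J.
Proof. by move=> idJ x Ix; exists x => //; exists 0; [exact: ideal0|rewrite addr0]. Qed.

Lemma sub_ideal_addr I J : is_ideal I -> J `<=` ideal_add I J.
Proof. by move=> idI x Ix; exists 0; [exact: ideal0|exists x => //; rewrite add0r]. Qed.

Lemma ideal_add_min I J C :
  is_ideal C -> I `<=` C -> J `<=` C -> ideal_add I J `<=` C.
Proof. by move=> idC IC JC _ [x /IC Cx [y /JC Cy <-]]; exact: idealD. Qed.

Definition colon A r : set R := [set x | A (x * r)].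

Lemma colon_ideal A r : is_ideal A -> is_ideal (colon A r).
Proof.
move=> idA; split=> [|x y Ax Ay|t x Ax]; rewrite /colon /=.
- by rewrite mul0r; exact: ideal0.
- by rewrite mulrDl; exact: idealD.
- by rewrite -mulrA; exact: idealMl.
Qed.

(** A nonzero multiple of the class of [w] gives [w] back, so [A]/[B] is zero or simple. The
    dichotomy mentions no maximal ideal, so that it also applies in the quotient rings defining
    j-stretchedness. *)
Lemma quot_length_le1 A B w : is_ideal B ->
  (forall x, A x -> exists r, B (x - r * w)) ->
  (forall r, B (r * w) \/ exists r', B (r' * (r * w) - w)) ->
  quot_length_le A B 1.
Proof.
move=> idB Aw rw N [|[|l]] // NAB Nlt.
have [_ []] := Nlt 1%N isT; have [N01 N10] := Nlt 0%N isT.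
have [id0 BN0 _] := NAB 0%N isT; have [id1 BN1 NA1] := NAB 1%N isT.
have [id2 BN2 NA2] := NAB 2%N isT.
have [x Nx N0x] : exists2 x, N 1%N x & ~ N 0%N x.
  by apply: contrapT => H; apply: N10 => x Nx; apply: contrapT => N0x; apply: H; exists x.
have [r Brx] := Aw _ (NA1 _ Nx).
have [Brw|[r' Br']] := rw r.
  by case: N0x; apply: (idealBr (BN0 _ Brx)) => //; exact: BN0.
have Nw : N 1%N w.
  rewrite -(subKr (r' * (r * w)) w); apply: idealB => //; last exact: BN1.
  apply: idealMl => //; rewrite -(subKr x (r * w)); apply: idealB => //; exact: BN1.
move=> y Ny; have [t Bt] := Aw _ (NA2 _ Ny).
by apply: (idealBr (BN1 _ Bt)) => //; exact: idealMl.
Qed.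

End IdealCalculus.
#[global] Hint Resolve ideal_seq_ideal ideal_mul_ideal ideal_exp_ideal
  ispan_ideal : core.

(** * Images of ideals under a surjective ring homomorphism *)

Section SurjectiveImage.
Variables (R S : comPzRingType) (f : {rmorphism R -> S}).
Hypothesis f_surj : forall y, exists x, f x = y.
Implicit Types (A B I : set R).

Lemma image_ideal A : is_ideal A -> is_ideal (f @` A).
Proof.
move=> idA; split.
- by exists 0; [exact: ideal0|rewrite rmorph0].
- move=> _ _ [x Ax <-] [y Ay <-]; exists (x + y); first exact: idealD.
  by rewrite rmorphD.
- move=> r _ [x Ax <-]; have [t <-] := f_surj r.
  by exists (t * x); [exact: idealMl|rewrite rmorphM].
Qed.

Lemma preimage_ideal (C : set S) : is_ideal C -> is_ideal (f @^-1` C).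
Proof.
move=> idC; split=> [|x y Cx Cy|r x Cx] /=.
- by rewrite rmorph0; exact: ideal0.
- by rewrite rmorphD; exact: idealD.
- by rewrite rmorphM; exact: idealMl.
Qed.

Lemma image_ideal_mul A B : ideal_mul (f @` A) (f @` B) = f @` ideal_mul A B.
Proof.
rewrite eqEsubset; split.
  apply: ideal_mul_min => [|_ _ [x Ax <-] [y By <-]]; first exact: image_ideal.
  by exists (x * y); [exact: mem_ideal_mul|rewrite rmorphM].
move=> _ [x ABx <-]; move: x ABx.
have idC := preimage_ideal (ideal_mul_ideal (f @` A) (f @` B)).
apply: (ideal_mul_min idC) => x y Ax By; rewrite /preimage /= rmorphM.
by apply: mem_ideal_mul; [exists x|exists y].
Qed.

Lemma image_ideal_exp I n : ideal_exp (f @` I) n = f @` ideal_exp I n.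
Proof.
elim: n => [|n IHn]; last by rewrite !ideal_expS IHn image_ideal_mul.
by rewrite eqEsubset; split=> y _ //; have [x <-] := f_surj y; exists x.
Qed.

Lemma image_ideal_seq (xs : seq R) :
  ideal_of_seq [seq f x | x <- xs] = f @` ideal_of_seq xs.
Proof.
rewrite eqEsubset; split.
  apply: ideal_seq_min => [|_ /mapP[x xxs ->]]; first exact: image_ideal.
  by exists x => //; exact: mem_ideal_seq.
move=> _ [x ABx <-]; move: x ABx.
have idC := preimage_ideal (ideal_seq_ideal [seq f x | x <- xs]).
by apply: (ideal_seq_min idC) => x xxs; apply: mem_ideal_seq; exact: map_f.
Qed.

Lemma image_ideal_add A B : ideal_add (f @` A) (f @` B) = f @` ideal_add A B.
Proof.
rewrite eqEsubset; split.
  by move=> _ [_ [x Ax <-] [_ [y By <-] <-]]; exists (x + y); rewrite ?rmorphD //;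
    exists x => //; exists y.
move=> _ [_ [x Ax [y By <-]] <-]; rewrite rmorphD.
by exists (f x); [exists x|exists (f y) => //; exists y].
Qed.

End SurjectiveImage.

(** * Noetherian local rings *)

Section LocalRing.
Variables (R : comNzRingType) (m : set R) (k : fieldType).
Variable res : {rmorphism R -> k}.
Hypotheses (noethR : noetherian R) (localR : is_local m).
Hypotheses (resP : is_residue_map m res) (k_infinite : infinite_set [set: k]).
Implicit Types (A B I J P : set R) (p s : seq R).

Lemma noetherian_max (Pr : set R -> Prop) A0 :
  (forall A, Pr A -> is_ideal A) -> Pr A0 ->
  exists A, [/\ Pr A, A0 `<=` A & forall B, Pr B -> A `<=` B -> B `<=` A].
Proof.
move=> Pr_ideal PrA0; apply: contrapT => nomax.
pose T := {A : set R | Pr A /\ A0 `<=` A}.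
have step (A : T) : exists B : T, sval A `<` sval B.
  case: A => A [PrA A0A]; apply: contrapT => noB; apply: nomax; exists A.
  split=> // B PrB AB; apply: contrapT => BA.
  by apply: noB; exists (exist _ B (conj PrB (subset_trans A0A AB))).
have [g gP] := choice step.
pose f n := iter n g (exist _ A0 (conj PrA0 (@subset_refl _ A0))).
have fle n n' : (n <= n')%N -> sval (f n) `<=` sval (f n').
  elim: n' => [|n' IHn]; first by rewrite leqn0 => /eqP ->.
  rewrite leq_eqVlt ltnS => /predU1P[-> //|/IHn sub].
  by apply: (subset_trans sub); case: (gP (f n')).
pose U := [set x | exists n, sval (f n) x].
have fI n : is_ideal (sval (f n)) by apply: Pr_ideal; case: (svalP (f n)).
have idU : is_ideal U.
  split=> [|x y [n fx] [n' fy]|r x [n fx]].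
  - by exists 0%N; exact: ideal0.
  - exists (maxn n n'); apply: idealD => //.
      exact: fle (leq_maxl _ _) _ fx.
    exact: fle (leq_maxr _ _) _ fy.
  - by exists n; exact: idealMl.
have [xs Uxs] := noethR idU.
have [N fN] : exists N, forall x, x \in xs -> sval (f N) x.
  have : forall x, x \in xs -> U x by move=> x; rewrite Uxs; exact: mem_ideal_seq.
  elim: (xs) => [|y ys IHys] Uy; first by exists 0%N.
  have [|N fN] := IHys; first by move=> x xys; apply: Uy; rewrite inE xys orbT.
  have [n fy] := Uy y (mem_head _ _).
  exists (maxn n N) => x; rewrite inE => /predU1P[->|/fN].
    exact: fle (leq_maxl _ _) _ fy.
  exact: fle (leq_maxr _ _) _.
have [_] := gP (f N); apply => x fx.
by apply: (ideal_seq_min (fI N) fN); rewrite -Uxs; exists N.+1.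
Qed.

Lemma noetherian_gen (S : set R) :
  exists2 ts : seq R, (forall t, t \in ts -> S t) & ideal_gen S = ideal_of_seq ts.
Proof.
pose Pr A := exists2 ts : seq R, (forall t, t \in ts -> S t) & A = ideal_of_seq ts.
have [||A [[ts tsS ->] _ maxts]] := @noetherian_max Pr (ideal_of_seq [::]).
- by move=> A [ts _ ->].
- by exists [::].
exists ts => //; rewrite eqEsubset; split; last first.
  by apply: ideal_seq_min => [|t /tsS]; [exact: ideal_gen_ideal|exact: sub_ideal_gen].
apply: ideal_gen_min => // t St.
apply: (maxts (ideal_of_seq (t :: ts))); last exact: ideal_seq_head.
  by exists (t :: ts) => // u; rewrite inE => /predU1P[->|/tsS].
exact: ideal_seq_behead.
Qed.

Lemma resE x : m x <-> res x = 0.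
Proof. by case: resP => _ /(_ x) []. Qed.

Lemma m_ideal : is_ideal m. Proof. by case: localR => -[]. Qed.
Hint Resolve m_ideal : core.

Lemma m_proper : ~ m 1. Proof. by case: localR => -[]. Qed.

Lemma res_lift (c : k) : exists x, res x = c.
Proof. by case: resP => /(_ c). Qed.

Lemma local_unit x : ~ m x -> exists y, y * x = 1.
Proof.
move=> mx; apply: contrapT => xunit; apply: mx.
pose Pr A := is_ideal A /\ ~ A 1.
have x1 : Pr (ideal_of_seq [:: x]).
  split=> // /ideal_seq_consP[r]; rewrite ideal_seq_nil /= => /eqP.
  by rewrite subr_eq0 => /eqP e; apply: xunit; exists r.
have [|A [[idA A1] xA maxA]] := @noetherian_max Pr _ _ x1; first by move=> A [].
have <- : A = m.
  apply: localR.2; split=> // J idJ J1 AJ.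
  by rewrite eqEsubset; split=> //; exact: maxA.
by apply: xA; exact: ideal_seq_head.
Qed.

Lemma res_unit x : res x != 0 -> exists y, y * x = 1.
Proof. by move=> /eqP rx; apply: local_unit; rewrite resE. Qed.

Lemma ideal_unit_cancel A x y : is_ideal A -> res x != 0 -> A (x * y) -> A y.
Proof.
move=> idA /res_unit[z zx] Axy; rewrite -(mul1r y) -zx -mulrA; exact: idealMl.
Qed.

Lemma proper_sub_m A : is_ideal A -> ~ A 1 -> A `<=` m.
Proof.
move=> idA A1 x Ax; apply: contrapT => /local_unit[y yx].
by apply: A1; rewrite -yx; exact: idealMl.
Qed.

Lemma m_prime : prime_ideal m.
Proof.
split=> //; first exact: m_proper.
move=> x y; rewrite !resE rmorphM /= => /eqP.
by rewrite mulf_eq0 => /orP[] /eqP; [left|right].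
Qed.

Lemma prime_expr P x n : prime_ideal P -> P (x ^+ n) -> P x.
Proof.
case=> idP P1 PP; elim: n => [|n IHn]; first by rewrite expr0 => /P1.
by rewrite exprS => /PP[].
Qed.

Lemma nakayama A B : is_ideal A -> is_ideal B ->
  A `<=` ideal_add B (ideal_mul m A) -> A `<=` B.
Proof.
move=> idA idB sub; have [hs eA] := noethR idA.
pose n := size hs; pose h (i : 'I_n) := hs`_i.
have {}eA : A = ispan h by rewrite eA ispan_nth.
have hA i : A (h i) by rewrite eA; exact: ispan_mem.
have step i : exists c : 'I_n -> R,
    (forall j, m (c j)) /\ B (h i - \sum_j c j * h j).
  have [b Bb [y my e]] := sub _ (hA i).
  move: my; rewrite ideal_mulC eA => /(ispan_mulP _ _ m_ideal)[c [mc ey]].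
  exists c; split=> //; rewrite -e ey.
  under [X in _ - X]eq_bigr do rewrite mulrC.
  by rewrite addrK.
have [c cP] := choice step.
(* The determinant trick: [M] is the identity modulo m, so [\det M] is a unit and [\adj M] recovers
   its multiples of the generators from elements of [B]. *)
pose M : 'M[R]_n := \matrix_(i, j) ((i == j)%:R - c i j).
have resM : res (\det M) != 0.
  rewrite -det_map_mx (_ : map_mx _ _ = 1%:M) ?det1 ?oner_eq0 //.
  apply/matrixP => i j; rewrite !mxE rmorphB rmorph_nat /=.
  by have [/(_ j) /resE -> _] := cP i; rewrite subr0.
rewrite eA; apply: ispan_min => // i.
apply: (ideal_unit_cancel idB resM).
have -> : \det M * h i = (\adj M *m (M *m \col_j h j)) i 0.
  by rewrite mulmxA mul_adj_mx mul_scalar_mx !mxE.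
rewrite mxE; apply: ideal_bigsum => // j _; apply: idealMl => //.
rewrite mxE; have [_] := cP j; congr B.
under [in RHS]eq_bigr do rewrite !mxE mulrBl.
rewrite sumrB; congr (_ - _).
rewrite (bigD1 j) //= eqxx mul1r big1 ?addr0 // => l /negPf.
by rewrite eq_sym => ->; rewrite mul0r.
Qed.

(** * Maximal annihilators and prime avoidance *)

Definition maxann A t :=
  ~ A t /\ forall u, ~ A u -> colon A t `<=` colon A u -> colon A u `<=` colon A t.

Lemma maxann_exists A u : is_ideal A -> ~ A u ->
  exists2 t, maxann A t & colon A u `<=` colon A t.
Proof.
move=> idA Au; pose Pr C := exists2 t, ~ A t & C = colon A t.
have [||C [[t At ->] ut maxt]] := @noetherian_max Pr (colon A u).
- by move=> C [t _ ->]; exact: colon_ideal.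
- by exists u.
by exists t => //; split=> // v Av; apply: maxt; exists v.
Qed.

(** If [y * t] is nonzero modulo [A], its annihilator contains that of [t], hence equals it. These
    primes are the maximal associated primes of R/[A]; by [maxann_exists] their union is the set of
    zero divisors. *)
Lemma maxann_prime A t : is_ideal A -> maxann A t -> prime_ideal (colon A t).
Proof.
move=> idA [At maxt]; split; first exact: colon_ideal.
  by rewrite /colon /= mul1r.
move=> x y; rewrite /colon /= => Axyt.
have [Ayt|Ayt] := pselect (A (y * t)); [by right|left].
apply: (maxt _ Ayt); last by rewrite /colon /= mulrA.
by move=> z; rewrite /colon /= mulrCA => Azt; exact: idealMl.
Qed.

(** A prime containing a finite intersection of ideals contains one of them. *)
Lemma prime_colon_seq A P (ts : seq R) : prime_ideal P ->
  (forall x, (forall t, t \in ts -> A (x * t)) -> P x) -> is_ideal A ->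
  exists2 t, t \in ts & colon A t `<=` P.
Proof.
move=> [idP P1 PP] tsP idA; elim: ts tsP => [|t ts IHts] tsP.
  by case: P1; exact: tsP.
have [tP|/existsNP[x /not_implyP[Axt Px]]] := pselect (colon A t `<=` P).
  by exists t => //; exact: mem_head.
have [|u uts uP] := IHts; last by exists u => //; rewrite inE uts orbT.
move=> y Ayts; have [|//|//] := PP x y.
apply: tsP => v; rewrite inE => /predU1P[->|/Ayts]; last first.
  by move=> ?; rewrite -mulrA; exact: idealMl.
by rewrite mulrAC mulrC; exact: idealMl.
Qed.

(** Finitely many elements [ts] generate the ideal spanned by all [t] with maximal annihilator. What
    kills all of [ts] kills each such [t], so the prime [colon A t] contains some [colon A u] with
    [u] in [ts], and maximality gives equality. *)
Lemma maxann_finite A : is_ideal A ->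
  exists2 ts : seq R, (forall t, t \in ts -> maxann A t) &
    forall t, maxann A t -> exists2 u, u \in ts & colon A t = colon A u.
Proof.
move=> idA; have [ts tsA tsE] := noetherian_gen (maxann A).
exists ts => // t At.
have [|u uts ut] := @prime_colon_seq A (colon A t) ts (maxann_prime idA At) _ idA.
  move=> x Axts; rewrite /colon /= mulrC.
  have : ideal_of_seq ts t by rewrite -tsE; exact: sub_ideal_gen.
  have idx : is_ideal (colon A x) by exact: colon_ideal.
  by move: t {At}; apply: ideal_seq_min => // t /Axts; rewrite /colon /= mulrC.
exists u => //; rewrite eqEsubset; split=> //.
by apply: (tsA _ uts).2 => //; case: At.
Qed.

Definition nzd A y := forall b, A (b * y) -> A b.

Lemma zero_divisors A : is_ideal A ->
  exists2 Ps : seq (set R),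
    (forall P, P \in Ps -> exists2 t, maxann A t & P = colon A t) &
    forall v, ~ nzd A v -> exists2 P, P \in Ps & P v.
Proof.
move=> idA; have [ts tsA tsE] := maxann_finite idA.
exists [seq colon A t | t <- ts].
  by move=> _ /mapP[t tts ->]; exists t => //; exact: tsA.
move=> v /existsNP[b /not_implyP[Abv Ab]].
have [t At bt] := maxann_exists idA Ab; have [u uts tu] := tsE _ At.
exists (colon A u); first exact: map_f.
by rewrite -tu; apply: bt; rewrite /colon /= mulrC.
Qed.

Lemma zero_divisors_seq (As : seq (set R)) : (forall A, A \in As -> is_ideal A) ->
  exists2 Ps : seq (set R),
    (forall P, P \in Ps ->
       exists A t, [/\ A \in As, maxann A t & P = colon A t]) &
    forall v, (forall P, P \in Ps -> ~ P v) -> forall A, A \in As -> nzd A v.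
Proof.
elim: As => [|A As IHAs] idAs; first by exists [::].
have [B BAs|Ps PsP Psv] := IHAs; first by apply: idAs; rewrite inE BAs orbT.
have [Qs QsP Qsv] := zero_divisors (idAs A (mem_head _ _)).
exists (Qs ++ Ps).
  move=> P; rewrite mem_cat => /orP[/QsP[t At ->]|/PsP[B [t [BAs Bt ->]]]].
    by exists A, t; rewrite mem_head.
  by exists B, t; rewrite inE BAs orbT.
move=> v nv B; rewrite inE => /predU1P[->|]; last first.
  by apply: Psv => P PPs; apply: nv; rewrite mem_cat PPs orbT.
apply: contrapT => /Qsv[P PQs Pv].
by apply: (nv P) => //; rewrite mem_cat PQs.
Qed.

Lemma residue_avoid (bs : seq k) : exists c : R, res c \notin bs.
Proof.
have [|t] := poly_nonroot k_infinite (p := \prod_(b <- bs) ('X - b%:P)).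
  by rewrite monic_neq0 // monic_prod_XsubC.
have [c <-] := res_lift t; exists c; apply: contra_neqN p => cbs.
by apply/eqP; rewrite -/(root _ _) root_prod_XsubC.
Qed.

(* Two multipliers with distinct residues differ by a unit, so for each ideal
   at most one residue class is bad. *)
Lemma avoid_step (Ps : seq (set R)) w y : (forall P, P \in Ps -> is_ideal P) ->
  exists c, forall P, P \in Ps -> P (w + c * y) -> P w /\ P y.
Proof.
move=> idPs.
have bad P : exists b, P \in Ps -> forall c, P (w + c * y) -> res c != b -> P w /\ P y.
  have [[c0 Pc0]|noc] := pselect (exists c, P (w + c * y)); last first.
    by exists 0 => _ c Pc; case: noc; exists c.
  exists (res c0) => PPs c Pc cc0; have idP := idPs P PPs.
  have Py : P y.
    apply: (@ideal_unit_cancel P (c - c0) y) => //; first by rewrite rmorphB subr_eq0.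
    have := idealB Pc Pc0 idP; congr P; ring.
  split=> //; apply: (@idealBr _ (- (c * y))); rewrite ?opprK //.
  by apply: idealN => //; exact: idealMl.
have [b bP] := choice bad; have [c cb] := residue_avoid (map b Ps).
exists c => P PPs Pc; apply: (bP P PPs c Pc).
by apply: contraNneq cb => ->; exact: map_f.
Qed.

Lemma avoid (Ps : seq (set R)) w (ys : seq R) : (forall P, P \in Ps -> is_ideal P) ->
  exists2 v, ideal_of_seq ys (v - w) &
    forall P, P \in Ps -> P v -> P w /\ forall y, y \in ys -> P y.
Proof.
move=> idPs; elim: ys => [|y ys [v vw vP]].
  by exists w => //; rewrite subrr; exact: ideal0.
have [c cP] := avoid_step v y idPs.
exists (v + c * y).
  by apply/ideal_seq_consP; exists c; rewrite addrAC addrK.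
move=> P PPs /(cP P PPs)[/(vP P PPs)[Pw Pys] Py]; split=> // z.
by rewrite inE => /predU1P[->|/Pys].
Qed.

(** * Regular sequences and depth *)

Definition mrad A := forall x, m x -> exists n, A (x ^+ n).

Lemma mrad_sub A B : A `<=` B -> mrad A -> mrad B.
Proof. by move=> AB radA x /radA[n /AB]; exists n. Qed.

Lemma prime_mrad A P : prime_ideal P -> A `<=` P -> mrad A -> m `<=` P.
Proof. by move=> primeP AP radA x /radA[n /AP /(prime_expr primeP)]. Qed.

(* The socle of R/A vanishes, i.e. R/A has positive depth. *)
Definition soc0 A := forall u, (forall x, m x -> A (x * u)) -> A u.

(** A maximal annihilator [colon A t] is a prime above [A], so it contains m and [t] is a nonzero
    socle class. *)
Lemma soc0_mrad A : is_ideal A -> ~ A 1 -> mrad A -> ~ soc0 A.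
Proof.
move=> idA A1 radA socA; have [t At _] := maxann_exists idA A1.
apply: (At.1); apply: socA; apply: (prime_mrad (maxann_prime idA At) _ radA).
by move=> x Ax; rewrite /colon /= mulrC; exact: idealMl.
Qed.

Lemma nzd_soc0 A y : m y -> nzd A y -> soc0 A.
Proof. by move=> my nzy u mu; apply: nzy; rewrite mulrC; exact: mu. Qed.

(** If [v] lay in a maximal annihilator [colon A t], so would [w], [ys] and hence m, and [t] would
    be a nonzero socle class. Several [As] at once allow a common regular element; a nonzero [w]
    allows a prescribed element to be corrected. *)
Lemma nzd_avoid (As : seq (set R)) w (ys : seq R) :
  (forall A, A \in As -> is_ideal A) ->
  (forall A, A \in As -> soc0 A) ->
  (forall A, A \in As -> forall P, prime_ideal P -> A `<=` P -> P w ->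
     (forall y, y \in ys -> P y) -> m `<=` P) ->
  exists2 v, ideal_of_seq ys (v - w) & forall A, A \in As -> nzd A v.
Proof.
move=> idAs socAs ysAs; have [Ps PsP Psv] := zero_divisors_seq idAs.
have idPs P : P \in Ps -> is_ideal P.
  by move=> /PsP[A [t [/idAs idA _ ->]]]; exact: colon_ideal.
have [v vw vP] := avoid w ys idPs; exists v => //; apply: Psv => P PPs Pv.
have [A [t [AAs At eP]]] := PsP P PPs.
have [Pw Pys] := vP P PPs Pv; apply: (At.1); apply: (socAs A AAs) => x mx.
suff : P x by rewrite eP.
have idA := idAs A AAs.
apply: (ysAs A AAs P _ _ Pw Pys) mx; first by rewrite eP; exact: maxann_prime.
by move=> y Ay; rewrite eP /colon /= mulrC; exact: idealMl.
Qed.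

(* The sequence s is regular on R/(p); only the ideal (p) matters, not p. *)
Fixpoint reg p s : Prop :=
  if s is y :: s' then nzd (ideal_of_seq p) y /\ reg (y :: p) s' else True.

Lemma reg_eq_mem p q s : p =i q -> reg p s -> reg q s.
Proof.
elim: s p q => [|y s IHs] p q pq //= [nzy regs].
split; first by rewrite -(ideal_seq_eq_mem pq).
by apply: IHs regs => z; rewrite !inE pq.
Qed.

Lemma reg_rcons p s y :
  reg p (rcons s y) <-> reg p s /\ nzd (ideal_of_seq (s ++ p)) y.
Proof.
elim: s p => [|z s IHs] p /=; first by split=> -[].
have -> : ideal_of_seq (z :: s ++ p) = ideal_of_seq (s ++ z :: p).
  by apply: ideal_seq_eq_mem => x; rewrite !(inE, mem_cat) orbCA.
split=> [[nz /IHs[]]|[[nz rs] nzy]] //.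
by split=> //; apply/IHs.
Qed.

Lemma nzd_swap_tail p y w :
  nzd (ideal_of_seq p) y -> nzd (ideal_of_seq (y :: p)) w ->
  nzd (ideal_of_seq p) w -> nzd (ideal_of_seq (w :: p)) y.
Proof.
move=> nzy nzyw nzw b /ideal_seq_consP[c pc].
have /ideal_seq_consP[c' pc'] : ideal_of_seq (y :: p) c.
  apply: nzyw; apply/ideal_seq_consP; exists b.
  by rewrite -opprB; exact: idealN.
apply/ideal_seq_consP; exists c'; apply: nzy.
rewrite mulrBl; apply: (@idealBr _ (w * (c - c' * y))) => //; last exact: idealMl.
have -> : b * y - c' * w * y - w * (c - c' * y) = b * y - c * w by ring.
by [].
Qed.

(** The annihilator [K] of [w] modulo (p) is contained in (p) + y K, so it vanishes modulo (p) by
    Nakayama. This makes regular sequences in m permutable. *)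
Lemma nzd_swap_head p y w : m y ->
  nzd (ideal_of_seq p) y -> nzd (ideal_of_seq (y :: p)) w ->
  nzd (ideal_of_seq p) w.
Proof.
move=> my nzy nzw; pose K := colon (ideal_of_seq p) w.
have idK : is_ideal K by exact: colon_ideal.
have : K `<=` ideal_of_seq p.
  apply: nakayama => // b Kb.
  have /nzw /ideal_seq_consP[c pc] : ideal_of_seq (y :: p) (b * w).
    exact: ideal_seq_behead.
  exists (b - c * y) => //; exists (y * c); last by rewrite mulrC subrK.
  apply: mem_ideal_mul => //; apply: nzy.
  have -> : c * w * y = b * w - w * (b - c * y) by ring.
  by apply: idealB => //; exact: idealMl.
by move=> sub b; exact: sub.
Qed.

Definition sub_m s := forall y, y \in s -> m y.

Lemma sub_m_cons y s : sub_m (y :: s) <-> m y /\ sub_m s.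
Proof.
split=> [H|[my ms] z]; last by rewrite inE => /predU1P[->|/ms].
by split=> [|z zs]; apply: H; rewrite inE ?eqxx ?zs ?orbT.
Qed.

Lemma reg_swap p x y s : m x -> reg p [:: x, y & s] -> reg p [:: y, x & s].
Proof.
move=> mx /= [nzx [nzy regs]].
have nzy' := nzd_swap_head mx nzx nzy.
split=> //; split; first exact: nzd_swap_tail.
by apply: reg_eq_mem regs => z; rewrite !inE orbCA.
Qed.

Lemma reg_rotl p s w : m w -> sub_m s -> reg p (w :: s) -> reg p (rcons s w).
Proof.
move=> mw; elim: s p => [|y s IHs] p //= /sub_m_cons[my ms] regw.
have [nzy regys] : reg p [:: y, w & s] by exact: reg_swap.
by split=> //; exact: IHs.
Qed.

Lemma reg_rotr p s w : m w -> sub_m s -> reg p (rcons s w) -> reg p (w :: s).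
Proof.
move=> mw; elim: s p => [|y s IHs] p //= /sub_m_cons[my ms] [nzy regsw].
by apply: (@reg_swap p y w s my) => /=; split=> //; exact: IHs.
Qed.

(** An element regular modulo every ideal of this list can be moved in front of a regular sequence
    [s], see [reg_nzd_front]. *)
Fixpoint prefixes p s : seq (set R) :=
  ideal_of_seq p :: if s is y :: s' then prefixes (y :: p) s' else [::].

Lemma prefixes_ideal p s A : A \in prefixes p s -> is_ideal A.
Proof.
by elim: s p => [|y s IHs] p; rewrite in_cons => /predU1P[-> //|//]; exact: IHs.
Qed.

Lemma reg_prefixes_soc0 p s y : m y -> sub_m s -> reg p (rcons s y) ->
  forall A, A \in prefixes p s -> soc0 A.
Proof.
move=> my; elim: s p => [|z s IHs] p /=.
  by move=> _ [nzy _] A; rewrite inE => /eqP ->; exact: nzd_soc0 nzy.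
move=> /sub_m_cons[mz ms] [nzz regs] A; rewrite in_cons => /predU1P[->|].
  exact: nzd_soc0 nzz.
exact: IHs.
Qed.

Lemma reg_nzd_front p s w : reg p s ->
  (forall A, A \in prefixes p s -> nzd A w) -> reg (w :: p) s.
Proof.
elim: s p => [|y s IHs] p //= [nzy regs] nzw.
have nzp : nzd (ideal_of_seq p) w by apply: nzw; rewrite mem_head.
have nzs A : A \in prefixes (y :: p) s -> nzd A w.
  by move=> As; apply: nzw; rewrite inE As orbT.
split.
  apply: nzd_swap_tail => //; apply: nzs.
  by case: (s) => [|? ?]; rewrite mem_head.
have : reg [:: w, y & p] s by exact: IHs.
by apply: reg_eq_mem => z; rewrite !inE orbCA.
Qed.

(** Both socles are Ext^1(k, R/(p)). Explicitly, a socle class u modulo z corresponds to the class v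
    modulo y with y u = v z, and v = c y gives u = c z. *)
Lemma soc0_exchange p y z : m y -> m z ->
  nzd (ideal_of_seq p) y -> nzd (ideal_of_seq p) z ->
  soc0 (ideal_of_seq (y :: p)) -> soc0 (ideal_of_seq (z :: p)).
Proof.
move=> my mz nzy nzz socy u mu.
have /ideal_seq_consP[v pv] := mu y my.
have /ideal_seq_consP[c pc] : ideal_of_seq (y :: p) v.
  apply: socy => x mx; have /ideal_seq_consP[c pc] := mu x mx.
  apply/ideal_seq_consP; exists c; apply: nzz.
  have -> : (x * v - c * y) * z = y * (x * u - c * z) - x * (y * u - v * z) by ring.
  by apply: idealB => //; exact: idealMl.
apply/ideal_seq_consP; exists c; apply: nzy.
have -> : (u - c * z) * y = (y * u - v * z) + z * (v - c * y) by ring.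
by apply: idealD => //; exact: idealMl.
Qed.

Lemma ideal_seq_cat_cons y s p :
  ideal_of_seq (s ++ y :: p) = ideal_of_seq (y :: s ++ p).
Proof. by apply: ideal_seq_eq_mem => z; rewrite !(inE, mem_cat) orbCA. Qed.

Lemma prefixes_last p s : ideal_of_seq (s ++ p) \in prefixes p s.
Proof.
elim: s p => [|y s IHs] p; first by rewrite mem_head.
by rewrite /= -ideal_seq_cat_cons inE IHs orbT.
Qed.

Lemma sub_m_rcons s y : sub_m (rcons s y) <-> m y /\ sub_m s.
Proof.
rewrite -sub_m_cons; split=> H z zs; apply: H; move: zs;
by rewrite mem_rcons.
Qed.

(* Exchange the last terms of both sequences for a common regular element w,
   move w to the front, and go on over R/(w). *)
Lemma soc0_reg n p ys zs : size ys = n -> size zs = n -> sub_m ys -> sub_m zs ->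
  reg p ys -> reg p zs ->
  soc0 (ideal_of_seq (ys ++ p)) -> soc0 (ideal_of_seq (zs ++ p)).
Proof.
elim: n p ys zs => [|n IHn] p ys zs; first by move=> /size0nil -> /size0nil ->.
case/lastP: ys => [|ys y]; first by [].
case/lastP: zs => [|zs z]; first by [].
rewrite !size_rcons => -[sys] [szs] mys mzs regy regz.
have [/sub_m_rcons[my {}mys] /sub_m_rcons[mz {}mzs]] := (mys, mzs).
have [[regys nzy] [regzs nzz]] := ((reg_rcons p ys y).1 regy, (reg_rcons p zs z).1 regz).
have [ms em] := noethR m_ideal.
have [|||w mw nzw] := @nzd_avoid (prefixes p ys ++ prefixes p zs) 0 ms.
- by move=> A; rewrite mem_cat => /orP[] /prefixes_ideal.
- move=> A; rewrite mem_cat => /orP[].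
    exact: (reg_prefixes_soc0 my mys).
  exact: (reg_prefixes_soc0 mz mzs).
- by move=> A _ P [idP _ _] _ _ Pms; rewrite em; exact: ideal_seq_min.
rewrite subr0 -em in mw.
have nzyw : nzd (ideal_of_seq (ys ++ p)) w.
  by apply: nzw; rewrite mem_cat prefixes_last.
have nzzw : nzd (ideal_of_seq (zs ++ p)) w.
  by apply: nzw; rewrite mem_cat prefixes_last orbT.
rewrite !cat_rcons !ideal_seq_cat_cons => socy.
apply: (soc0_exchange mw mz) => //; rewrite -ideal_seq_cat_cons.
apply: (IHn _ ys) => //.
- by apply: reg_nzd_front => // A As; apply: nzw; rewrite mem_cat As.
- by apply: reg_nzd_front => // A As; apply: nzw; rewrite mem_cat As orbT.
by rewrite ideal_seq_cat_cons; apply: soc0_exchange socy.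
Qed.

Lemma regular_sequence_reg s : regular_sequence s -> reg [::] s.
Proof.
case=> _ regs.
have : forall n, (n <= size s)%N -> reg [::] (take n s).
  elim=> [|n IHn] ns; first by rewrite take0.
  rewrite (take_nth 0) //; apply/reg_rcons; split; first exact: IHn (ltnW ns).
  by rewrite cats0 => b; rewrite mulrC; exact: regs.
by move/(_ _ (leqnn _)); rewrite take_size.
Qed.

Lemma reg_take p s n : reg p s -> reg p (take n s).
Proof. by elim: s p n => [|y s IHs] p [|n] //= [nzy /IHs]. Qed.

Section Depth.
Variables (zs : seq R) (regz : reg [::] zs) (mz : sub_m zs).

(** Comparison with the initial segment of [zs] of the same length, modulo which the next term of
    [zs] is still regular. *)
Lemma soc0_depth ys : reg [::] ys -> sub_m ys -> (size ys < size zs)%N ->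
  soc0 (ideal_of_seq ys).
Proof.
move=> regy my ltyz; rewrite -(cats0 ys).
apply: (@soc0_reg (size ys) [::] (take (size ys) zs)) => //.
- by rewrite size_take ltyz.
- by move=> z /mem_take /mz.
- exact: reg_take.
have := reg_take (size ys).+1 regz.
rewrite (take_nth 0) // => /reg_rcons[_]; apply: nzd_soc0.
by apply: mz; exact: mem_nth.
Qed.

(* The generators are corrected one at a time by later ones, so as to avoid the
   maximal annihilators, and the correction is undone after moving the
   corrected element to the end. *)
Lemma sop_reg_rel p ys : reg [::] (rev p) -> sub_m p -> sub_m ys ->
  (size p + size ys <= size zs)%N -> mrad (ideal_of_seq (ys ++ p)) -> reg p ys.
Proof.
elim: ys p => [|y ys IHys] p //= regp mp /sub_m_cons[my mys] sz radyp.
have [|||v vy nzv] := @nzd_avoid [:: ideal_of_seq p] y ys.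
- by move=> A; rewrite inE => /eqP ->.
- move=> A; rewrite inE => /eqP ->; have -> : ideal_of_seq p = ideal_of_seq (rev p).
    by apply: ideal_seq_eq_mem => z; rewrite mem_rev.
  apply: soc0_depth => //; first by move=> z; rewrite mem_rev; exact: mp.
  by rewrite size_rev; apply: leq_trans sz; rewrite addnS ltnS leq_addr.
- move=> A; rewrite inE => /eqP -> P primeP pP Py Pys.
  have [idP _ _] := primeP.
  apply: (prime_mrad primeP _ radyp); apply: ideal_seq_min => // z.
  rewrite inE mem_cat => /predU1P[-> //|/orP[/Pys //|zp]].
  by apply: pP; exact: mem_ideal_seq.
have {}nzv : nzd (ideal_of_seq p) v by apply: nzv; rewrite mem_head.
have idys : is_ideal (ideal_of_seq (ys ++ p)) by [].
have vyp : ideal_of_seq (ys ++ p) (v - y).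
  by move: vy; apply: ideal_seq_sub => z; rewrite mem_cat => ->.
have mid : is_ideal m by exact: m_ideal.
have mv : m v.
  have : m (v - y) by move: vy; apply: ideal_seq_min.
  by move/idealBr; apply.
have regv : reg (v :: p) ys.
  apply: IHys => //.
  - by rewrite rev_cons; apply/reg_rcons; split=> //; rewrite cats0;
      have -> : ideal_of_seq (rev p) = ideal_of_seq p
        by apply: ideal_seq_eq_mem => z; rewrite mem_rev.
  - by apply/sub_m_cons.
  - by rewrite /= addSnnS.
  apply: mrad_sub radyp; apply: ideal_seq_cons_min => //.
    apply: (@idealBr _ v) => //; last by apply: mem_ideal_seq; rewrite mem_cat mem_head orbT.
    rewrite -opprB; apply: idealN => //; move: vyp; apply: ideal_seq_sub => z.
    by rewrite !mem_cat inE => /orP[] ->; rewrite ?orbT.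
  by apply: ideal_seq_sub => z; rewrite !mem_cat inE => /orP[] ->; rewrite ?orbT.
have : reg p (v :: ys) by [].
move=> /(reg_rotl mv mys) /reg_rcons[regys nzv'].
suff /(reg_rotr my mys) : reg p (rcons ys y) by [].
apply/reg_rcons; split=> // b yb; apply: nzv'.
have -> : b * v = b * y + b * (v - y) by ring.
by apply: idealD => //; exact: idealMl.
Qed.

Lemma sop_reg ys : sub_m ys -> (size ys <= size zs)%N -> mrad (ideal_of_seq ys) ->
  reg [::] ys.
Proof. by move=> mys sz rady; apply: sop_reg_rel => //; rewrite cats0. Qed.

(** A shorter [ys] would be a regular sequence by [sop_reg], and the socle modulo it would be zero
    by [soc0_depth] but nonzero by [soc0_mrad]. *)
Lemma mrad_size ys : sub_m ys -> mrad (ideal_of_seq ys) -> (size zs <= size ys)%N.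
Proof.
move=> mys rady; rewrite leqNgt; apply/negP => ltyz.
have socy := soc0_depth (sop_reg mys (ltnW ltyz) rady) mys ltyz.
apply: soc0_mrad rady socy => // y1; apply: m_proper.
by move: y1; apply: ideal_seq_min => //; exact: m_ideal.
Qed.

End Depth.

(** Once [y] is rotated to the end, it is regular modulo the other terms, which settles its
    coefficient; the remaining ones follow by induction modulo [y]. *)
Lemma reg_syzygy p s (r : nat -> R) : sub_m s -> reg p s ->
  ideal_of_seq p (\sum_(i < size s) r i * s`_i) ->
  forall i, (i < size s)%N -> ideal_of_seq (s ++ p) (r i).
Proof.
elim: s p r => [|y s IHs] p r //= /sub_m_cons[my ms] regys.
rewrite big_ord_recl /= => pr.
have regs : reg p s /\ nzd (ideal_of_seq (s ++ p)) y.
  by apply/reg_rcons; exact: reg_rotl.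
have sub : ideal_of_seq (s ++ p) `<=` ideal_of_seq (y :: s ++ p).
  exact: ideal_seq_behead.
case=> [_|i /=].
  apply: sub; apply: regs.2.
  apply: (@idealBr _ (- \sum_(i < size s) r i.+1 * s`_i)) => //.
    rewrite opprK; move: pr; apply: ideal_seq_sub => z; rewrite mem_cat orbC.
    by move=> ->.
  apply: idealN => //; apply: ideal_bigsum => // i _; apply: idealMl => //.
  by apply: mem_ideal_seq; rewrite mem_cat mem_nth.
rewrite ltnS => ltis; rewrite -ideal_seq_cat_cons.
apply: (IHs (y :: p) (fun j => r j.+1)) => //; first by case: regys.
apply: (@idealBr _ (- (r 0%N * y))) => //.
  by rewrite opprK addrC; exact: ideal_seq_behead.
by apply: idealN => //; apply: idealMl => //; exact: ideal_seq_head.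
Qed.

(** * Prime chains along a regular sequence *)

Lemma prime_avoiding A (S : set R) : is_ideal A -> S 1 ->
  (forall x y, S x -> S y -> S (x * y)) -> (forall x, A x -> ~ S x) ->
  exists P, [/\ prime_ideal P, A `<=` P & forall x, P x -> ~ S x].
Proof.
move=> idA S1 SM AS.
pose Pr C := is_ideal C /\ forall x, C x -> ~ S x.
have [|//|P [[idP PS] AP maxP]] := @noetherian_max Pr A; first by move=> C [].
exists P; split=> //; split=> //; first by move/PS.
have meets z : ~ P z -> exists r, exists2 s, S s & P (s - r * z).
  move=> Pz; apply: contrapT => noS; apply: Pz.
  pose C := [set x | exists r, P (x - r * z)].
  have idC : is_ideal C.
    split=> [|u v [r Pu] [t Pv]|t u [r Pu]].
    - by exists 0; rewrite mul0r subr0; exact: ideal0.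
    - by exists (r + t); rewrite mulrDl opprD addrACA; exact: idealD.
    - by exists (t * r); rewrite -mulrA -mulrBr; exact: idealMl.
  apply: (maxP C); last by exists 1; rewrite mul1r subrr; exact: ideal0.
    by split=> // x [r Px] Sx; apply: noS; exists r, x.
  by move=> x Px; exists 0; rewrite mul0r subr0.
move=> x y Pxy; apply: contrapT => /not_orP[/meets[r [s Ss Pr1]] /meets[t [u Su Pr2]]].
apply: (PS (s * u)); last exact: SM.
have -> : s * u = u * (s - r * x) + r * x * (u - t * y) + r * t * (x * y) by ring.
by do !apply: idealD => //; exact: idealMl.
Qed.

(** [Q] is chosen to avoid all products of an element outside [P] and a power of [y]. None of them
    lies in [A], because [y] can be cancelled modulo [A] and [A] is inside [P]. *)
Lemma prime_below A P y : prime_ideal P -> is_ideal A -> A `<=` P -> nzd A y ->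
  exists Q, [/\ prime_ideal Q, A `<=` Q, Q `<=` P & ~ Q y].
Proof.
move=> [idP P1 PP] idA AP nzy.
pose S := [set x | exists t n, ~ P t /\ x = t * y ^+ n].
have PSM t u : ~ P t -> ~ P u -> ~ P (t * u) by move=> Pt Pu /PP[].
have [||||Q [primeQ AQ QS]] := @prime_avoiding A S => //.
- by exists 1, 0%N; rewrite expr0 mulr1.
- move=> _ _ [t [n [Pt ->]]] [u [n' [Pu ->]]]; exists (t * u), (n + n')%N.
  by split; [exact: PSM|rewrite exprD; ring].
- move=> x Ax [t [n [Pt e]]]; apply: Pt; apply: AP; rewrite {}e in Ax.
  elim: n Ax => [|n IHn]; first by rewrite expr0 mulr1.
  by rewrite exprSr mulrA => /nzy.
exists Q; split=> // [x Qx|Qy].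
  by apply: contrapT => Px; apply: (QS x Qx); exists x, 0%N; rewrite expr0 mulr1.
by apply: (QS y Qy); exists 1, 1%N; rewrite mul1r.
Qed.

Lemma reg_prime_chain p s Q : prime_ideal Q -> reg p s -> ideal_of_seq (s ++ p) `<=` Q ->
  exists2 P : nat -> set R, prime_chain (size s) P & P (size s) = Q.
Proof.
elim/last_ind: s Q => [|s y IHs] Q primeQ; first by exists (fun=> Q).
move=> /reg_rcons[regs nzy] sQ.
have sub : ideal_of_seq (s ++ p) `<=` Q.
  by apply: subset_trans sQ; rewrite cat_rcons ideal_seq_cat_cons; exact: ideal_seq_behead.
have [Q' [primeQ' sQ' QQ' Qy]] := prime_below primeQ (ideal_seq_ideal _) sub nzy.
have [P [primeP chainP] PQ] := IHs Q' primeQ' regs sQ'.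
exists (fun n => if (n <= size s)%N then P n else Q); last first.
  by rewrite size_rcons ltnn.
rewrite size_rcons; split=> n nle; first by case: ifP => // /primeP.
have /predU1P[->|lt_ns] : (n == size s) || (n < size s)%N.
  by rewrite -leq_eqVlt -ltnS.
  rewrite leqnn ltnn PQ; split=> // QQ; apply: Qy; apply: QQ; apply: sQ.
  by apply: mem_ideal_seq; rewrite mem_cat mem_rcons mem_head.
by rewrite (ltnW lt_ns) lt_ns; exact: chainP.
Qed.

(** A prime above [s] missing some [x] of m would end a chain of length [d] built from the regular
    sequence, and m would prolong this chain. *)
Lemma reg_mrad d s : has_krull_dim R d -> reg [::] s -> sub_m s -> size s = d ->
  mrad (ideal_of_seq s).
Proof.
move=> [_ dimR] regs ms szs x mx; apply: contrapT => noX.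
pose S := [set x ^+ n | n in [set: nat]].
have [||||Q [primeQ sQ QS]] := @prime_avoiding (ideal_of_seq s) S => //.
- by exists 0%N.
- by move=> _ _ [n _ <-] [n' _ <-]; exists (n + n')%N; rewrite ?exprD.
- by move=> y sy [n _ e]; apply: noX; exists n; rewrite e.
have [|||P [primeP chainP] PQ] := @reg_prime_chain [::] s Q => //.
  by rewrite cats0.
have [idQ Q1 _] := primeQ; have Qm := proper_sub_m idQ Q1.
suff : (d.+1 <= d)%N by rewrite ltnn.
apply: (dimR _ (fun n => if (n <= d)%N then P n else m)).
split=> n nle; first by case: ifP => [nd|_]; [apply: primeP; rewrite szs|exact: m_prime].
have /predU1P[->|lt_nd] : (n == d) || (n < d)%N by rewrite -leq_eqVlt -ltnS.
  rewrite leqnn ltnn -szs PQ; split=> // mQ; apply: (QS x); last by exists 1%N.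
  exact: mQ.
by rewrite (ltnW lt_nd) lt_nd; apply: chainP; rewrite szs.
Qed.

(** * Generic elements *)

Lemma meval_res n (q : {mpoly R[n]}) (v : 'I_n -> R) :
  (map_mpoly res q).@[fun i => res (v i)] = res q.@[v].
Proof.
elim/mpolyind: q => [|c u q _ _ IHq]; first by rewrite raddf0 !meval0 rmorph0.
rewrite raddfD !mevalD rmorphD IHq; congr (_ + _).
rewrite /= map_mpolyZ map_mpolyX !mevalZ rmorphM; congr (_ * _).
rewrite !mevalX rmorph_prod; apply: eq_bigr => l _.
by rewrite rmorphXn.
Qed.

Section Generic.
Variables (d s : nat) (a : 'I_s -> R).

Definition lincomb (L : 'M[R]_(d, s)) : 'I_d -> R :=
  fun i => \sum_(j < s) L i j * a j.

Definition mxeval (F : nzRingType) (L : 'M[F]_(d, s)) (q : {mpoly F[d * s]}) : F :=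
  q.@[fun l => mxvec L 0 l].

Lemma mxeval_res (L : 'M[R]_(d, s)) (q : {mpoly R[d * s]}) :
  mxeval (map_mx res L) (map_mpoly res q) = res (mxeval L q).
Proof.
rewrite -meval_res; apply: meval_eq => l.
by rewrite -map_mxvec mxE.
Qed.

Lemma mxeval_sum (F : comNzRingType) (L : 'M[F]_(d, s)) (T : Type) (r : seq T)
    (h : T -> {mpoly F[d * s]}) :
  mxeval L (\sum_(i <- r) h i) = \sum_(i <- r) mxeval L (h i).
Proof. exact: (raddf_sum (meval _)). Qed.

Definition mxvar (i : 'I_d) (j : 'I_s) : {mpoly R[d * s]} := 'X_(mxvec_index i j).

Lemma mxeval_var (L : 'M[R]_(d, s)) i j : mxeval L (mxvar i j) = L i j.
Proof. by rewrite /mxeval mevalXU mxvecE. Qed.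

Lemma mxeval_onto (v : 'I_(d * s) -> k) :
  exists L : 'M[R]_(d, s), forall l, v l = mxvec (map_mx res L) 0 l.
Proof.
have [c cv] := choice (fun l => res_lift (v l)).
exists (vec_mx (\row_l c l)) => l.
by rewrite map_vec_mx vec_mxK !mxE cv.
Qed.

Lemma mxeval_map_mpoly0 (q : {mpoly R[d * s]}) :
  (forall L, m (mxeval L q)) -> map_mpoly res q = 0.
Proof.
move=> qm; apply: contrapT => /eqP /(mpoly_nonvanishing k_infinite)[v].
have [L /funext ->] := mxeval_onto v.
rewrite -/(mxeval _ _) mxeval_res => /eqP; apply; apply/resE; exact: qm.
Qed.

(* Unlike [for_general], this concerns the coefficient matrices, and the open
   set is a principal one. *)
Definition generic (Pr : 'M[R]_(d, s) -> Prop) :=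
  exists2 q : {mpoly k[d * s]}, q != 0 &
    forall L, mxeval (map_mx res L) q != 0 -> Pr L.

Lemma generic_eval (Pr : 'M[R]_(d, s) -> Prop) (q : {mpoly R[d * s]}) L0 :
  res (mxeval L0 q) != 0 -> (forall L, res (mxeval L q) != 0 -> Pr L) ->
  generic Pr.
Proof.
move=> q0 qPr; exists (map_mpoly res q).
  by apply: contraNneq q0 => q0; rewrite -mxeval_res q0 /mxeval meval0.
by move=> L; rewrite mxeval_res; exact: qPr.
Qed.

Lemma generic_sub (Pr Qr : 'M[R]_(d, s) -> Prop) :
  (forall L, Pr L -> Qr L) -> generic Pr -> generic Qr.
Proof. by move=> PQ [q q0 qP]; exists q => // L /qP /PQ. Qed.

Lemma generic_and (Pr Qr : 'M[R]_(d, s) -> Prop) :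
  generic Pr -> generic Qr -> generic (fun L => Pr L /\ Qr L).
Proof.
move=> [p p0 pP] [q q0 qQ]; exists (p * q); first by rewrite mulf_neq0.
move=> L; rewrite /mxeval mevalM mulf_eq0 negb_or => /andP[/pP ? /qQ ?].
by split.
Qed.

Lemma generic_ex (Pr : 'M[R]_(d, s) -> Prop) : generic Pr -> exists L, Pr L.
Proof.
move=> [q /(mpoly_nonvanishing k_infinite)[v qv] qP].
have [L vL] := mxeval_onto v; exists L; apply: qP.
by move: qv; rewrite (funext vL).
Qed.

(** A nonempty open set contains a nonempty principal one, and over an infinite field the latter is
    dense, since a product of nonzero polynomials has a nonzero value. *)
Lemma for_generalP (t : s.-tuple R) (Pr : d.-tuple R -> Prop) : a = tnth t ->
  for_general res t Pr <-> generic (fun L => Pr (mktuple (lincomb L))).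
Proof.
move=> ea.
have tE L : mktuple (lincomb L) = [tuple \sum_(j < s) L i j * tnth t j | i < d].
  by apply: eq_mktuple => i; rewrite /lincomb ea.
split=> [[U [[F UF] denseU UP]]|[q q0 qP]].
- have open0 : zariski_open [set: 'M[k]_(d, s)].
    exists [set 1]; rewrite setCT eqEsubset; split=> // M /(_ _ erefl) /eqP.
    by rewrite meval1 oner_eq0.
  have [M [UM _]] := denseU _ open0 (ex_intro _ (0 : 'M[k]_(d, s)) I).
  have /existsNP[q /not_implyP[Fq qM]] :
      ~ forall q, F q -> q.@[fun l => mxvec M 0 l] = 0.
    by have : ~ (~` U) M by []; rewrite UF.
  exists q; first by apply: contra_notN qM => /eqP ->; rewrite meval0.
  move=> L qL; rewrite tE; apply: UP; apply: contrapT => nU.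
  have : (~` U) (map_mx res L) by [].
  by rewrite UF => /(_ _ Fq); apply/eqP.
- exists [set M | mxeval M q != 0]; split=> [||L]; last by rewrite -tE; exact: qP.
  + exists [set q]; rewrite eqEsubset; split=> M /=.
      by move=> /negP; rewrite negbK => /eqP qM _ ->.
    by move=> /(_ _ erefl) qM; apply/negP; rewrite negbK; apply/eqP.
  + move=> V [F VF] [M VM].
    have /existsNP[p /not_implyP[Fp pM]] :
        ~ forall g, F g -> g.@[fun l => mxvec M 0 l] = 0.
      by have : ~ (~` V) M by []; rewrite VF.
    have p0 : p != 0 by apply: contra_notN pM => /eqP ->; rewrite meval0.
    have [v] := mpoly_nonvanishing k_infinite (mulf_neq0 q0 p0).
    have [L /funext ->] := mxeval_onto v.
    rewrite mevalM mulf_eq0 negb_or => /andP[qL pL].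
    exists (map_mx res L); split=> //; apply: contrapT => nV.
    have : (~` V) (map_mx res L) by [].
    by rewrite VF => /(_ _ Fp); apply/eqP.
Qed.

Section Core.
Variables (N : nat) (u : 'I_N -> 'I_d) (b : 'I_N -> R) (w : R) (C : set R).
Variable L0 : 'M[R]_(d, s).
Hypothesis spanC : forall j l, exists c : 'I_N -> R, exists e : R,
  C (a j * b l - \sum_l' c l' * (lincomb L0 (u l') * b l') - e * w).

(* Near L0 the products x_i(L) b_l are obtained from those at L0 by a matrix
   which is the identity at L0, hence can be inverted by Cramer's rule. *)
Lemma generic_cramer : exists (D : {mpoly R[d * s]}) (F : 'I_N -> {mpoly R[d * s]}),
  [/\ mxeval L0 D = 1, forall l, mxeval L0 (F l) = 0 &
      forall L K, C `<=` K -> (forall l, K (lincomb L (u l) * b l)) -> is_ideal K ->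
        forall l, K (mxeval L D * (lincomb L0 (u l) * b l) - mxeval L (F l) * w)].
Proof.
have [c cP] := choice (fun jl : 'I_s * 'I_N => spanC jl.1 jl.2).
have [e eP] := choice cP.
pose y i j : {mpoly R[d * s]} := mxvar i j - (L0 i j)%:MP.
have yE L i j : mxeval L (y i j) = L i j - L0 i j.
  by rewrite /mxeval mevalB mevalC -/(mxeval _ _) mxeval_var.
(* Write x_i(L) as x_i(L0) plus the sum of the [y i j * a j] and rewrite each product a_j b_l by
   [spanC]. Modulo [C], the products at [L] become [M] times those at [L0] plus [E * w]. *)
pose M : 'M[{mpoly R[d * s]}]_N :=
  \matrix_(l, l') ((l == l')%:R + \sum_j y (u l) j * (c (j, l) l')%:MP).
pose E : 'cV[{mpoly R[d * s]}]_N := \col_l \sum_j y (u l) j * (e (j, l))%:MP.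
have evM L l l' : mxeval L (M l l') =
    (l == l')%:R + \sum_j (L (u l) j - L0 (u l) j) * c (j, l) l'.
  rewrite mxE /mxeval mevalD rmorph_nat -/(mxeval _ _) mxeval_sum; congr (_ + _).
  by apply: eq_bigr => j _; rewrite /mxeval mevalM mevalC -/(mxeval _ _) yE.
have evE L l : mxeval L (E l 0) = \sum_j (L (u l) j - L0 (u l) j) * e (j, l).
  rewrite mxE mxeval_sum.
  by apply: eq_bigr => j _; rewrite /mxeval mevalM mevalC -/(mxeval _ _) yE.
exists (\det M), (fun l => - (\adj M *m E) l 0); split.
- rewrite /mxeval -det_map_mx (_ : map_mx _ _ = 1%:M) ?det1 //.
  apply/matrixP => l l'; rewrite [LHS]mxE /= -/(mxeval L0 _) evM mxE big1 ?addr0 // => j _.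
  by rewrite subrr mul0r.
- move=> l; rewrite /mxeval mevalN mxE -/(mxeval _ _) mxeval_sum big1 ?oppr0 // => l' _.
  by rewrite /mxeval mevalM -!/(mxeval _ _) evE big1 ?mulr0 // => j _; rewrite subrr mul0r.
move=> L K CK KL idK l; pose v l := lincomb L0 (u l) * b l.
have Kl l' : K (\sum_l'' mxeval L (M l' l'') * v l'' + mxeval L (E l' 0) * w).
  rewrite evE; under eq_bigr do rewrite evM mulrDl.
  rewrite big_split /= (bigD1 l') //= eqxx mul1r big1 ?addr0; last first.
    by move=> l'' /negPf; rewrite eq_sym => ->; rewrite mul0r.
  pose z := \sum_j (L (u l') j - L0 (u l') j) *
     (a j * b l' - \sum_l'' c (j, l') l'' * v l'' - e (j, l') * w).
  have Kz : K z.
    apply: ideal_bigsum => // j _; apply: idealMl => //; apply: CK.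
    exact: (eP (j, l')).
  have zE : z = lincomb L (u l') * b l' - v l'
      - \sum_j (L (u l') j - L0 (u l') j) * (\sum_l'' c (j, l') l'' * v l'')
      - (\sum_j (L (u l') j - L0 (u l') j) * e (j, l')) * w.
    rewrite /z; under [LHS]eq_bigr do rewrite !mulrBr.
    rewrite !sumrB; congr (_ - _ - _).
      rewrite /v /lincomb -mulrBl -sumrB big_distrl /=; apply: eq_bigr => j _.
      by rewrite -mulrBl mulrA.
    by rewrite big_distrl /=; apply: eq_bigr => j _; rewrite mulrA.
  have := idealB (KL l') Kz idK; congr K; rewrite zE.
  have -> : \sum_i (\sum_j (L (u l') j - L0 (u l') j) * c (j, l') i) * v i =
     \sum_j (L (u l') j - L0 (u l') j) * (\sum_l'' c (j, l') l'' * v l'').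
    under eq_bigr do rewrite big_distrl /=.
    rewrite exchange_big /=; apply: eq_bigr => j _; rewrite big_distrr /=.
    by apply: eq_bigr => l'' _; rewrite mulrA.
  ring.
have : K (\sum_l' mxeval L (\adj M l l') *
    (\sum_l'' mxeval L (M l' l'') * v l'' + mxeval L (E l' 0) * w)).
  by apply: ideal_bigsum => // l' _; apply: idealMl.
congr K; under eq_bigr do rewrite mulrDr.
rewrite big_split /=; congr (_ + _); last first.
  rewrite /mxeval mevalN mulNr opprK mxE -/(mxeval _ _) mxeval_sum big_distrl /=.
  by apply: eq_bigr => l' _; rewrite /mxeval mevalM mulrA.
under eq_bigr do rewrite big_distrr /=.
rewrite exchange_big /=.
have adjM l'' : \sum_l' mxeval L (\adj M l l') * mxeval L (M l' l'')
    = mxeval L (\det M) * (l == l'')%:R.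
  have := congr1 (fun A : 'M_N => mxeval L (A l l'')) (mul_adj_mx M).
  rewrite !mxE mxeval_sum; under eq_bigr do rewrite /mxeval mevalM -!/(mxeval _ _).
  by move=> ->; rewrite mulr_natr /mxeval mevalMn.
transitivity (\sum_l'' mxeval L (\det M) * (l == l'')%:R * v l'').
  apply: eq_bigr => l'' _; rewrite -adjM big_distrl /=.
  by apply: eq_bigr => l' _; rewrite mulrA.
rewrite (bigD1 l) //= eqxx mulr1 big1 ?addr0 // => l'' /negPf.
by rewrite eq_sym => ->; rewrite mulr0 mul0r.
Qed.

End Core.

Notation genJ L := (ispan (lincomb L)).

Variables (I : set R).
Hypothesis Ia : I = ispan a.

Lemma lincomb_mem L i : I (lincomb L i).
Proof.
by rewrite Ia; apply: ideal_bigsum => [j _|]; [apply: idealMl => //; exact: ispan_mem|].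
Qed.

Lemma genJ_sub L : genJ L `<=` I.
Proof. by apply: ispan_min => [|i]; [rewrite Ia|exact: lincomb_mem]. Qed.

Lemma lincomb_onto (h : 'I_d -> R) : (forall i, I (h i)) ->
  exists L, lincomb L = h.
Proof.
move=> Ih; have step i : exists c : 'I_s -> R, h i = \sum_j c j * a j.
  by apply/ispanP; rewrite -Ia.
have [c cP] := choice step; exists (\matrix_(i, j) c i j).
by apply/funext => i; rewrite cP; apply: eq_bigr => j _; rewrite mxE.
Qed.

Section Family.
Variables (B C : set R) (idB : is_ideal B) (idC : is_ideal C).

Definition cofactor_ideal L := ideal_add (ideal_mul (genJ L) B) C.

Lemma cofactor_ideal_ideal L : is_ideal (cofactor_ideal L).
Proof. exact: ideal_add_ideal. Qed.
Hint Resolve cofactor_ideal_ideal : core.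

Lemma generic_cramer_ideal L0 w :
  (forall x, ideal_mul I B x -> exists e, cofactor_ideal L0 (x - e * w)) ->
  exists N (v : 'I_N -> R) (D : {mpoly R[d * s]}) (F : 'I_N -> {mpoly R[d * s]}),
  [/\ ideal_mul (genJ L0) B = ispan v,
      mxeval L0 D = 1, forall l, mxeval L0 (F l) = 0 &
      forall L l, cofactor_ideal L (mxeval L D * v l - mxeval L (F l) * w)].
Proof.
move=> H; have [bs eB] := noethR idB.
pose g (i : 'I_(size bs)) := bs`_i.
have {}eB : B = ispan g by rewrite eB ispan_nth.
pose T := ('I_d * 'I_(size bs))%type.
pose v L (l : 'I_#|{: T}|) := lincomb L (enum_val l).1 * g (enum_val l).2.
have vE L : ideal_mul (genJ L) B = ispan (v L).
  rewrite eB ispan_mul_ispan -ispan_enum_val; congr ispan.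
have [|D [F [D0 F0 DF]]] := @generic_cramer #|{: T}| (fun l => (enum_val l).1)
    (fun l => g (enum_val l).2) w C L0.
- move=> j l; have [|e [x]] := H (a j * g (enum_val l).2).
    by apply: mem_ideal_mul; [rewrite Ia|rewrite eB]; exact: ispan_mem.
  rewrite vE => /ispanP[c ->] [y Cy e_xy]; exists c, e.
  move: Cy; congr C; move: e_xy; rewrite /v addrC => /eqP.
  by rewrite eq_sym subr_eq => /eqP ->; ring.
exists #|{: T}|, (v L0), D, F; split=> // L l.
apply: DF => [|l'|] //; first by apply: sub_ideal_addr.
apply: sub_ideal_addl => //; apply: mem_ideal_mul; first exact: ispan_mem.
by rewrite eB; exact: ispan_mem.
Qed.

(** The Cramer identities with w = 0: where [D] is a unit, the generators of J(L0) B lie in the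
    ideal at [L]. *)
Lemma generic_cover L0 : ideal_mul I B `<=` cofactor_ideal L0 ->
  generic (fun L => ideal_mul I B `<=` cofactor_ideal L).
Proof.
move=> sub; have [|N [v [D [F [vE D0 F0 DF]]]]] := @generic_cramer_ideal L0 0.
  by move=> x /sub; exists 0; rewrite mulr0 subr0.
apply: (@generic_eval _ D L0); first by rewrite D0 rmorph1 oner_eq0.
move=> L DL; apply: (subset_trans sub); apply: ideal_add_min => //.
  rewrite vE; apply: ispan_min => // l; apply: (ideal_unit_cancel _ DL) => //.
  by have := DF L l; rewrite mulr0 subr0.
exact: sub_ideal_addr.
Qed.

(** A module of length at most 1 is one that is cyclic and killed by m. Naming the generator allows
    it to stay the same while [L] varies. *)
Definition colength_le1 L := exists w,
  [/\ ideal_mul I B w,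
      forall x, ideal_mul I B x -> exists e, cofactor_ideal L (x - e * w) &
      forall y, m y -> cofactor_ideal L (y * w)].

Lemma mpoly_coeff_span n t (g : 'I_t -> R) (q : {mpoly R[n]}) :
  (forall u, ispan g q@_u) ->
  exists h : 'I_t -> {mpoly R[n]}, q = \sum_l (g l)%:MP * h l.
Proof.
move=> qg; have [c cP] := choice (fun u => (ispanP g _).1 (qg u)).
exists (fun l => \sum_(u <- msupp q) c u l *: 'X_[u]).
rewrite [LHS]mpolyE.
under [RHS]eq_bigr do rewrite big_distrr /=.
rewrite exchange_big /=; apply: eq_bigr => u _.
rewrite [X in X *: _]cP scaler_suml; apply: eq_bigr => l _.
by rewrite mul_mpolyC scalerA mulrC.
Qed.

(* If w generates the quotient I B / (J B + C) with m w = 0 at L0, then for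
   generic L the Cramer identities give polynomials g_j with g_j(L) w = 0
   near L and g_j(L0) = mu_j, where the mu_j generate m.  Either some g_j(L) is
   a unit, and then the quotient vanishes generically; or all coefficients of
   the g_j lie in m, and then g = Q mu for a matrix Q equal to 1 at L0. *)
Lemma generic_colength_le1 L0 : colength_le1 L0 -> generic colength_le1.
Proof.
move=> [w [Aw wA mw]].
have [[L1 sub1]|nosub] := pselect (exists L1, ideal_mul I B `<=` cofactor_ideal L1).
  apply: generic_sub (generic_cover sub1) => L sub; exists 0.
  split=> [|x /sub|y _]; first exact: ideal0.
    by exists 0; rewrite mulr0 subr0.
  by rewrite mulr0; exact: ideal0.
have [N [v [D [F [vE D0 F0 DF]]]]] := generic_cramer_ideal wA.
have [ms em] := noethR m_ideal; pose t := size ms.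
pose mu (j : 'I_t) := ms`_j; have {}em : m = ispan mu by rewrite em ispan_nth.
have mmu j : m (mu j) by rewrite em; exact: ispan_mem.
have muw j : exists c : 'I_N -> R, C (mu j * w - \sum_l c l * v l).
  have [x + [y Cy <-]] := mw _ (mmu j).
  by rewrite vE => /ispanP[c ->]; exists c; rewrite addrC addKr.
have [c cP] := choice muw.
(* Multiply the relation between [mu j * w] and the [v l] by [D], then replace each [D * v l] by
   [F l * w]: what remains is a multiple of [w] in the ideal at every [L]. *)
pose g j := D * (mu j)%:MP - \sum_l (c j l)%:MP * F l.
have gE L j : mxeval L (g j) =
    mxeval L D * mu j - \sum_l c j l * mxeval L (F l).
  rewrite /g /mxeval mevalB mevalM mevalC -!/(mxeval _ _) mxeval_sum.
  by congr (_ - _); apply: eq_bigr => l _; rewrite /mxeval mevalM mevalC.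
have g0 j : mxeval L0 (g j) = mu j.
  by rewrite gE D0 mul1r big1 ?subr0 // => l _; rewrite F0 mulr0.
have gw L j : cofactor_ideal L (mxeval L (g j) * w).
  have -> : mxeval L (g j) * w =
      mxeval L D * (mu j * w - \sum_l c j l * v l)
      + \sum_l c j l * (mxeval L D * v l - mxeval L (F l) * w).
    under [X in _ = _ + X]eq_bigr do rewrite mulrBr.
    rewrite sumrB gE.
    have -> : \sum_l c j l * (mxeval L D * v l) = mxeval L D * \sum_l c j l * v l.
      by rewrite big_distrr; apply: eq_bigr => l _; rewrite mulrCA.
    have -> : \sum_l c j l * (mxeval L (F l) * w) = (\sum_l c j l * mxeval L (F l)) * w.
      by rewrite big_distrl; apply: eq_bigr => l _; rewrite mulrA.
    ring.
  apply: idealD => //; first by apply: idealMl => //; apply: sub_ideal_addr.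
  by apply: ideal_bigsum => // l _; exact: idealMl.
have wcover L : res (mxeval L D) != 0 -> cofactor_ideal L w ->
    cofactor_ideal L0 `<=` cofactor_ideal L.
  move=> DL Lw; apply: ideal_add_min => //; last exact: sub_ideal_addr.
  rewrite vE; apply: ispan_min => // l; apply: (ideal_unit_cancel _ DL) => //.
  by apply: (idealBr (DF L l)) => //; exact: idealMl.
(* If both factors were units at [L], the ideal at [L] would contain [w], then the ideal at [L0],
   then all of I B, against [nosub]. As [D] is nonzero modulo m, all coefficients of [g j] must lie
   in m. *)
have Dg L j : m (mxeval L (D * g j)).
  apply/resE; rewrite /mxeval mevalM -!/(mxeval _ _) rmorphM /=; apply/eqP.
  apply: contrapT => /negP; rewrite mulf_eq0 negb_or => /andP[DL gL].
  have Lw : cofactor_ideal L w by apply: (ideal_unit_cancel _ gL).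
  apply: nosub; exists L => x /wA[e xew].
  by apply: (idealBr (wcover L DL Lw _ xew)) => //; exact: idealMl.
have Dneq0 : map_mpoly res D != 0.
  apply/eqP => D00; have : res (mxeval L0 D) = 0.
    by rewrite -mxeval_res D00 /mxeval meval0.
  by rewrite D0 rmorph1 => /eqP; rewrite oner_eq0.
have g_coeff j : exists h : 'I_t -> {mpoly R[d * s]}, g j = \sum_l (mu l)%:MP * h l.
  apply: mpoly_coeff_span => u; rewrite -em; apply/resE.
  rewrite -mcoeff_map_mpoly.
  have /eqP := mxeval_map_mpoly0 (Dg^~ j); rewrite rmorphM mulf_eq0 (negPf Dneq0) /=.
  by move=> /eqP ->; rewrite mcoeff0.
have [h hP] := choice g_coeff.
(* The values of the [h j l] at [L0] combine the [mu l] to [mu j], as the identity matrix does;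
   exchanging one for the other preserves g = Q mu. Then [\adj Q] expresses [\det Q * mu j] through
   the [g l], which kill [w] modulo the ideal at [L]. *)
pose Q : 'M[{mpoly R[d * s]}]_t :=
  \matrix_(j, l) (h j l - (mxeval L0 (h j l))%:MP + (j == l)%:R).
have QE L j l : mxeval L (Q j l) = mxeval L (h j l) - mxeval L0 (h j l) + (j == l)%:R.
  by rewrite mxE /mxeval mevalD mevalB mevalC rmorph_nat.
have gQ L j : mxeval L (g j) = \sum_l mxeval L (Q j l) * mu l.
  have hE L' : mxeval L' (g j) = \sum_l mxeval L' (h j l) * mu l.
    rewrite hP mxeval_sum; apply: eq_bigr => l _.
    by rewrite /mxeval mevalM mevalC mulrC.
  under eq_bigr do rewrite QE mulrDl mulrBl.
  rewrite big_split sumrB /= -!hE g0 (bigD1 j) //= eqxx mul1r big1 ?addr0 ?subrK //.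
  by move=> l /negPf; rewrite eq_sym => ->; rewrite mul0r.
apply: (@generic_eval _ (D * \det Q) L0).
  rewrite /mxeval mevalM -/(mxeval _ _) D0 mul1r -det_map_mx.
  rewrite (_ : map_mx _ _ = 1%:M) ?det1 ?rmorph1 ?oner_eq0 //.
  by apply/matrixP => j l; rewrite [LHS]mxE /= -/(mxeval L0 _) QE subrr add0r mxE.
move=> L; rewrite /mxeval mevalM rmorphM mulf_eq0 negb_or -!/(mxeval _ _).
move=> /andP[DL QL].
have vL l : exists e, cofactor_ideal L (v l - e * w).
  have [y yD] := res_unit DL; exists (y * mxeval L (F l)).
  have := @idealMl _ y _ _ (DF L l) (cofactor_ideal_ideal L); congr cofactor_ideal.
  by rewrite mulrBr !mulrA yD mul1r.
have cofL x : cofactor_ideal L0 x -> exists e, cofactor_ideal L (x - e * w).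
  move=> [y + [z Cz <-]]; rewrite vE => /ispanP[r ->].
  have [e eP] := choice vL; exists (\sum_l r l * e l).
  have -> : \sum_l r l * v l + z - (\sum_l r l * e l) * w =
      \sum_l r l * (v l - e l * w) + z.
    under [X in _ = X + _]eq_bigr do rewrite mulrBr mulrA.
    by rewrite sumrB -big_distrl /= addrAC.
  apply: idealD => //; last exact: sub_ideal_addr.
  by apply: ideal_bigsum => // l _; exact: idealMl.
exists w; split=> // [x /wA[e /cofL[e' xe]]|y].
  by exists (e + e'); rewrite mulrDl opprD addrA.
suff wmu : m `<=` colon (cofactor_ideal L) w by exact: wmu.
rewrite em; apply: ispan_min => [|j]; first exact: colon_ideal.
rewrite /colon /=; apply: (ideal_unit_cancel _ QL) => //.
pose QL' := map_mx (meval (fun l => mxvec L 0 l)) Q; pose gc := QL' *m \col_l mu l.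
have gcE l : gc l 0 = mxeval L (g l).
  by rewrite gQ mxE; apply: eq_bigr => j' _; rewrite !mxE.
have -> : mxeval L (\det Q) * (mu j * w) = (\adj QL' *m gc) j 0 * w.
  rewrite /gc mulmxA mul_adj_mx mul_scalar_mx !mxE mulrA; congr (_ * _ * _).
  by rewrite det_map_mx.
rewrite mxE big_distrl /=; apply: ideal_bigsum => // l _.
by rewrite gcE -mulrA; exact: idealMl.
Qed.

End Family.

(** * Openness of independence over R/I *)

Lemma generic_det n (G : 'I_d -> 'I_s -> 'M[k]_n) (L0 : 'M[R]_(d, s)) :
  \det (\sum_i \sum_j res (L0 i j) *: G i j) != 0 ->
  generic (fun L => \det (\sum_i \sum_j res (L i j) *: G i j) != 0).
Proof.
pose X i j : {mpoly k[d * s]} := 'X_(mxvec_index i j).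
pose M := \sum_i \sum_j X i j *: map_mx (@mpolyC _ k) (G i j).
have evM L : mxeval (map_mx res L) (\det M) = \det (\sum_i \sum_j res (L i j) *: G i j).
  rewrite /mxeval -det_map_mx; congr (\det _).
  rewrite /M raddf_sum; apply: eq_bigr => i _; rewrite raddf_sum; apply: eq_bigr => j _.
  apply/matrixP => x y; rewrite !mxE /= mevalM mevalC; congr (_ * _).
  by rewrite mevalXU mxvecE mxE.
move=> det0; exists (\det M); last by move=> L; rewrite evM.
by apply: contraNneq det0 => M0; rewrite -(evM L0) M0 /mxeval meval0.
Qed.

(* For E = I^2: the classes of the x_i(L) are linearly independent in I/I^2
   over R/I, which implies J L `&` I^2 = (J L) I. *)
Definition indep_mod E L := forall r : 'I_d -> R,
  E (\sum_i r i * lincomb L i) -> forall i, I (r i).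

Lemma socle_basis A : is_ideal A -> exists n (t : 'I_n -> R),
  [/\ forall q y, m y -> A (y * t q),
      forall x, (forall y, m y -> A (y * x)) ->
        exists c : 'I_n -> R, A (x - \sum_q c q * t q) &
      forall c : 'I_n -> R, A (\sum_q c q * t q) -> forall q, m (c q)].
Proof.
move=> idA; pose soc := [set x | forall y, m y -> A (y * x)].
have idS : is_ideal soc.
  split=> [y _|x z Sx Sz y my|r x Sx y my] /=; first by rewrite mulr0; exact: ideal0.
    by rewrite mulrDr; apply: idealD => //; [exact: Sx|exact: Sz].
  by rewrite mulrCA; apply: idealMl => //; exact: Sx.
pose Pr n := `[< exists2 t : 'I_n -> R, forall q, soc (t q) &
  forall x, soc x -> exists c : 'I_n -> R, A (x - \sum_q c q * t q) >].
have exPr : exists n, Pr n.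
  have [ts eS] := noethR idS; exists (size ts); apply/asboolP.
  exists (fun i : 'I_(size ts) => ts`_i) => [q|x].
    by rewrite eS; apply: mem_ideal_seq; exact: mem_nth.
  rewrite eS ispan_nth => /ispanP[c ->]; exists c.
  by rewrite subrr; exact: ideal0.
case: (ex_minnP exPr) => n /asboolP[t St tP] minn.
exists n, t; split=> [q y my|x Sx|c Ac q]; [exact: St|exact: tP|].
apply/resE/eqP; apply: contrapT => /negP cq.
case: n t c q St tP Ac cq minn => [|n] t c q St tP Ac cq minn; first by case: q cq.
suff /minn : Pr n by rewrite ltnn.
apply/asboolP; exists (fun i => t (lift q i)) => [i|x /tP[e xe]]; first exact: St.
have [y yc] := res_unit cq.
exists (fun i => e (lift q i) - e q * y * c (lift q i)).
have := idealD xe (@idealMl _ (e q * y) _ _ Ac idA) idA; congr A.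
have split_sum (f : 'I_n.+1 -> R) : \sum_i f i = f q + \sum_i f (lift q i).
  by rewrite (bigD1_ord q).
rewrite !split_sum.
have -> : \sum_i (e (lift q i) - e q * y * c (lift q i)) * t (lift q i) =
    \sum_i e (lift q i) * t (lift q i) - e q * y * \sum_i c (lift q i) * t (lift q i).
  by rewrite mulr_sumr -sumrB; apply: eq_bigr => i _; ring.
set S1 := \sum_i e _ * _; set S2 := \sum_i c _ * _.
have -> : e q * y * (c q * t q + S2) = e q * (y * c q) * t q + e q * y * S2 by ring.
by rewrite yc; ring.
Qed.

(** A tuple that is nonzero modulo [I] has a nonzero multiple with entries in the socle of R/I, so
    coefficients from the socle suffice as a test. For these only residues matter: independence says
    that c is sent injectively to c^T L modulo a fixed subspace of matrices over k, which a
    determinant detects. *)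
Lemma generic_indep E L0 : is_ideal E -> ideal_exp I 2 `<=` E -> mrad I -> ~ I 1 ->
  indep_mod E L0 -> generic (indep_mod E).
Proof.
move=> idE I2E radI I1 indep0.
have idI : is_ideal I by rewrite Ia.
have IIE x y : I x -> I y -> E (x * y).
  by move=> Ix Iy; apply: I2E; apply: (@ideal_expD_mem _ I 1 1); rewrite ideal_exp1.
have Iaj j : I (a j) by rewrite Ia; exact: ispan_mem.
have [n [t [tI t_gen t_free]]] := socle_basis idI.
pose Zl (H : 'M[R]_(n, s)) := E (\sum_q \sum_j H q j * (t q * a j)).
(* m times [t q] lies in [I], and [I] times [a j] lies in [E]. *)
have Zl_res H H' : map_mx res H = map_mx res H' -> Zl H -> Zl H'.
  move=> HH; rewrite /Zl => EH.
  apply: (idealBr _ EH) => //; rewrite -sumrB; apply: ideal_bigsum => // q _.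
  rewrite -sumrB; apply: ideal_bigsum => // j _; rewrite -mulrBl mulrA.
  apply: IIE => //; apply: tI; apply/resE; rewrite rmorphB.
  by have /matrixP/(_ q j) := HH; rewrite !mxE => ->; rewrite subrr.
have ZlE (c : 'M[R]_(d, n)) L :
    \sum_q \sum_j (c^T *m L) q j * (t q * a j) = \sum_i (\sum_q c i q * t q) * lincomb L i.
  under eq_bigr do (under eq_bigr do rewrite mxE big_distrl /=).
  under eq_bigr do rewrite exchange_big /=.
  rewrite exchange_big; apply: eq_bigr => i _; rewrite /lincomb big_distrlr /=.
  by apply: eq_bigr => q _; apply: eq_bigr => j _; rewrite mxE; ring.
pose Z v := exists2 H, v = mxvec (map_mx res H) & Zl H.
have [|||A AP] := @subspace_matrix k (n * s) Z.
- exists 0; first by rewrite map_mx0 linear0.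
  by rewrite /Zl big1 => [|q _]; [exact: ideal0|rewrite big1 // => j _; rewrite mxE mul0r].
- move=> _ _ [H -> ZH] [H' -> ZH']; exists (H + H'); first by rewrite map_mxD linearD.
  have := idealD ZH ZH' idE; congr E; rewrite -big_split /=; apply: eq_bigr => q _.
  by rewrite -big_split /=; apply: eq_bigr => j _; rewrite mxE mulrDl.
- move=> e _ [H -> ZH]; have [x <-] := res_lift e; exists (x *: H).
    by rewrite map_mxZ linearZ.
  have := @idealMl _ x _ _ ZH idE; congr E; rewrite big_distrr /=; apply: eq_bigr => q _.
  by rewrite big_distrr /=; apply: eq_bigr => j _; rewrite mxE; ring.
pose inj_at L := forall c : 'M[k]_(d, n), Z (mxvec (c^T *m map_mx res L)) -> c = 0.
have lift_mx (c : 'M[k]_(d, n)) : exists c' : 'M[R]_(d, n), c = map_mx res c'.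
  have [f fP] := choice (fun iq : 'I_d * 'I_n => res_lift (c iq.1 iq.2)).
  by exists (\matrix_(i, q) f (i, q)); apply/matrixP => i q; rewrite !mxE fP.
have inj0 : inj_at L0.
  move=> c; have [{}c ->] := lift_mx c => -[H].
  rewrite map_trmx -map_mxM => /(can_inj mxvecK) /esym /Zl_res /[apply].
  rewrite /Zl ZlE => /indep0 Ic; apply/matrixP => i q; rewrite !mxE.
  by apply/resE; apply: t_free (Ic i) q.
have indep_inj L : inj_at L -> indep_mod E L.
  move=> injL r Er; apply: contrapT => /existsNP[i0 ri0].
  (* The annihilator of the class of [r] in (R/I)^d. It is proper with radical m, so some u outside
     [Cl] has m u inside it, and the entries of u r are socle classes that do not all vanish. *)
  pose Cl := [set x | forall i, I (x * r i)].
  have idCl : is_ideal Cl.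
    split=> [i|x y Cx Cy i|x y Cy i] /=; first by rewrite mul0r; exact: ideal0.
      by rewrite mulrDl; exact: idealD.
    by rewrite -mulrA; exact: idealMl.
  have Cl1 : ~ Cl 1 by move=> /(_ i0); rewrite mul1r.
  have radCl : mrad Cl.
    by apply: mrad_sub radI => x Ix i; rewrite mulrC; exact: idealMl.
  have := soc0_mrad idCl Cl1 radCl; apply => u uP i1; move: i1.
  have step i : exists c : 'I_n -> R, I (u * r i - \sum_q c q * t q).
    by apply: t_gen => y my; rewrite mulrA; exact: uP.
  have [c cP] := choice step.
  have : Zl ((\matrix_(i, q) c i q)^T *m L).
    rewrite /Zl ZlE.
    have Eur : E (u * \sum_i r i * lincomb L i) by exact: idealMl.
    apply: (idealBr _ Eur) => //; rewrite big_distrr /= -sumrB; apply: ideal_bigsum => // i _.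
    rewrite mulrA -mulrBl; apply: IIE; last exact: lincomb_mem.
    rewrite -opprB; apply: idealN => //; have := cP i; congr I; congr (_ - _).
    by apply: eq_bigr => q _; rewrite mxE.
  move=> Zc; have : map_mx res (\matrix_(i, q) c i q) = 0.
    apply: injL; rewrite map_trmx -map_mxM; by eexists.
  move=> /matrixP c0 i; apply: (idealBr (cP i)) => //; apply: ideal_bigsum => // q _.
  by apply: tI; apply/resE; have := c0 i q; rewrite !mxE.
pose lin L : 'M[k]_(d * n, n * s) := lin_mx (mulmxr L \o trmx).
have lin_inj L (v : 'rV_(d * n)) : inj_at L ->
    v *m (lin (map_mx res L) *m cokermx A) = 0 -> v = 0.
  move=> injL; rewrite mulmxA => /eqP; rewrite -submxE => /AP.
  by rewrite -{1}(vec_mxK v) mul_vec_lin /= => /injL v0; rewrite -(vec_mxK v) v0 linear0.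
(* The right inverse at [L0] is kept fixed: it makes the matrices at all [L] square, so that one
   determinant controls injectivity. *)
have [C linC] : exists C, lin (map_mx res L0) *m cokermx A *m C = 1%:M.
  by apply/row_freeP; apply: inj_row_free => v; exact: lin_inj.
pose G (i : 'I_d) (j : 'I_s) := lin (delta_mx i j) *m cokermx A *m C.
have GE (L : 'M[R]_(d, s)) : \sum_i \sum_j res (L i j) *: G i j =
    lin (map_mx res L) *m cokermx A *m C.
  rewrite /G -[RHS]mulmxA; under eq_bigr do (under eq_bigr do rewrite -mulmxA scalemxAl).
  under eq_bigr do rewrite -mulmx_suml.
  rewrite -mulmx_suml; congr (_ *m _); apply/row_matrixP => l.
  rewrite !rowE -[delta_mx 0 l]vec_mxK mul_vec_lin /= [map_mx res L in RHS]matrix_sum_delta.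
  rewrite !mulmx_sumr !linear_sum; apply: eq_bigr => i _.
  rewrite !mulmx_sumr !linear_sum; apply: eq_bigr => j _.
  by rewrite mxE !linearZ /= mul_vec_lin.
apply: generic_sub (@generic_det _ G L0 _) => [L|].
  move=> detL; apply: indep_inj => c Zc.
  have vG : mxvec c *m (\sum_i \sum_j res (L i j) *: G i j) = 0.
    rewrite GE mulmxA [mxvec c *m _]mulmxA mul_vec_lin /=; have := (AP _).1 Zc.
    by rewrite submxE => /eqP ->; rewrite mul0mx.
  apply: (can_inj mxvecK); rewrite linear0.
  have unitG : (\sum_i \sum_j res (L i j) *: G i j) \in unitmx.
    by rewrite unitmxE unitfE.
  by rewrite -(mulmxK unitG (mxvec c)) vG mul0mx.
by rewrite GE linC det1 oner_eq0.
Qed.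

End Generic.

(** * Lengths *)

Section Length.
Implicit Types (N : nat -> set R).

(** Repetitions are deleted. This is needed because adding an ideal to a strict chain, or
    intersecting with one, may destroy strictness. *)
Lemma quot_length_weak_chain A B n N l : quot_length_le A B n ->
  (forall i, (i <= l)%N -> [/\ is_ideal (N i), B `<=` N i & N i `<=` A]) ->
  (forall i, (i < l)%N -> N i `<=` N i.+1) ->
  (count (fun i => `[< N i `<` N i.+1 >]) (iota 0 l) <= n)%N.
Proof.
move=> AB NAB Nle; pose c l' := count (fun i => `[< N i `<` N i.+1 >]) (iota 0 l').
have cS l' : c l'.+1 = (c l' + `[< N l' `<` N l'.+1 >])%N.
  by rewrite /c -[in iota _ _.+1]addn1 iotaD count_cat /= add0n addn0.
suff : forall l', (l' <= l)%N -> exists M : nat -> set R,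
    [/\ forall i, (i <= c l')%N -> [/\ is_ideal (M i), B `<=` M i & M i `<=` A],
        forall i, (i < c l')%N -> M i `<` M i.+1 & M (c l') = N l'].
  by move=> /(_ l (leqnn l))[M [MAB Mlt _]]; exact: (AB M (c l) MAB Mlt).
elim=> [|l' IHl] ll; first by exists N; split=> // i; rewrite leqn0 => /eqP ->; exact: NAB.
have [M [MAB Mlt Ml]] := IHl (ltnW ll); rewrite cS.
case: asboolP => [NN|NN]; last first.
  exists M; rewrite addn0; split=> //; rewrite Ml eqEsubset; split; first exact: Nle.
  by apply: contrapT => NN'; apply: NN; split; [exact: Nle|].
exists (fun i => if (i <= c l')%N then M i else N l'.+1); rewrite addn1.
split=> [i ic|i|]; [|rewrite ltnS => ic|by rewrite ltnn].
  by case: ifP => [/MAB|_] //; exact: NAB.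
case: ltnP => [lt_ic|le_ci]; first by rewrite ic; exact: Mlt.
by rewrite ic (_ : i = c l') ?Ml //; apply/eqP; rewrite eqn_leq ic.
Qed.

(** By the modular law a strict step stays strict after adding [B] or after intersecting with [B],
    so it is counted in at least one of the two weak chains. *)
Lemma quot_length_trans A B C n n' : is_ideal A -> is_ideal B -> B `<=` A -> C `<=` B ->
  quot_length_le A B n -> quot_length_le B C n' -> quot_length_le A C (n + n').
Proof.
move=> idA idB BA CB AB BC N l NAC Nlt.
pose P := fun i => ideal_add (N i) B; pose Q := fun i => N i `&` B.
have idN i : (i <= l)%N -> is_ideal (N i) by move=> /NAC[].
have idQ i : (i <= l)%N -> is_ideal (Q i).
  move=> /idN idNi; split=> [|x y [Nx Bx] [Ny By]|r x [Nx Bx]]; split;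
  by [exact: ideal0|exact: idealD|exact: idealMl].
have cP := @quot_length_weak_chain A B n P l AB.
have cQ := @quot_length_weak_chain B C n' Q l BC.
have Nle i : (i < l)%N -> N i `<=` N i.+1 by move=> /Nlt[].
apply: leq_trans (leq_add (cP _ _) (cQ _ _)).
- rewrite -count_predUI; apply: leq_trans (leq_addr _ _).
  rewrite -[X in (X <= _)%N](size_iota 0) -count_predT; apply/eq_leq/eq_in_count => i.
  rewrite mem_iota add0n => /andP[_ il] /=; apply/esym/orP.
  apply: contrapT => /not_orP[nP nQ].
  have [_] := Nlt i il; apply => x Nx.
  have idNi := idN _ (ltnW il).
  have Px : P i x.
    have : P i.+1 x by exact: sub_ideal_addl.
    apply: contrapT => nPx; apply: nP; apply/asboolP; split=> [y [u Nu [v Bv <-]]|sub].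
      by exists u; [exact: Nle|exists v].
    by apply: nPx; apply: sub; exact: sub_ideal_addl.
  case: Px => y Ny [z Bz e]; rewrite -e; apply: idealD => //.
  have : Q i.+1 z.
    split=> //; apply: (@idealBr _ (- y)); rewrite ?opprK //; last exact: idN.
      by rewrite addrC e.
    by apply: idealN; [exact: Nle|exact: idN].
  move=> Qz; apply: contrapT => Nz; apply: nQ; apply/asboolP; split=> [u [Nu Bu]|sub].
    by split=> //; exact: Nle.
  by apply: Nz; case: (sub z Qz).
- move=> i il; have [idNi CN NA] := NAC i il; split; first exact: ideal_add_ideal.
    exact: sub_ideal_addr.
  exact: ideal_add_min.
- by move=> i il x [u Nu [v Bv <-]]; exists u; [exact: Nle|exists v].
- move=> i il; have [idNi CN NA] := NAC i il; split; first exact: idQ.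
    by move=> x Cx; split; [exact: CN|exact: CB].
  by move=> x [].
- by move=> i il x [Nx Bx]; split=> //; exact: Nle.
Qed.

Lemma quot_length_sub A A' B B' n : A' `<=` A -> B `<=` B' ->
  quot_length_le A B n -> quot_length_le A' B' n.
Proof.
move=> AA BB AB N l NAB; apply: AB => i /NAB[idN BN NA]; split=> //.
  exact: subset_trans BN.
exact: subset_trans AA.
Qed.

(** Multiplication by [z ^+ D] maps R/(z, p) onto this quotient; chains are pulled back along it. *)
Lemma quot_length_expS p z D n : quot_length_le setT (ideal_of_seq (z :: p)) n ->
  quot_length_le (ideal_of_seq (z ^+ D :: p)) (ideal_of_seq (z ^+ D.+1 :: p)) n.
Proof.
move=> len N l NAB Nlt; apply: (len (fun i => colon (N i) (z ^+ D))) => i il.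
  have [idN BN NA] := NAB i il; split=> //; first exact: colon_ideal.
  apply: ideal_seq_min => [|x]; first exact: colon_ideal.
  rewrite inE /colon => /predU1P[->|xp] /=.
    by rewrite -exprS; apply: BN; exact: ideal_seq_head.
  by apply: idealMr => //; apply: BN; apply: ideal_seq_behead; exact: mem_ideal_seq.
have [Nle NN] := Nlt i il; split=> [x|sub]; first exact: Nle.
have [idN BN _] := NAB i (ltnW il); have [_ _ NA] := NAB i.+1 il.
apply: NN => x Nx; have /ideal_seq_consP[r pr] := NA x Nx.
have Npr : N i (x - r * z ^+ D) by apply: BN; exact: ideal_seq_behead.
apply: (idealBr Npr) => //; apply: sub; rewrite /colon /=.
have [idN' _ _] := NAB i.+1 il.
by rewrite -(subKr x (r * _)); apply: idealB => //; exact: Nle.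
Qed.

Lemma quot_length_exp p z D n : quot_length_le setT (ideal_of_seq (z :: p)) n ->
  quot_length_le setT (ideal_of_seq (z ^+ D :: p)) (D * n).
Proof.
move=> len; elim: D => [|D IHD].
  move=> N [//|l] NAB Nlt; have [_ BN _] := NAB 0%N isT.
  have [_] := Nlt 0%N isT; case=> x _; have [idN _ _] := NAB 0%N isT.
  rewrite -(mulr1 x); apply: idealMl => //; apply: BN; rewrite expr0.
  exact: ideal_seq_head.
rewrite mulSn addnC.
apply: quot_length_trans IHD (quot_length_expS len) => //.
apply: ideal_seq_cons_min => //; last exact: ideal_seq_behead.
by rewrite exprS; apply: idealMl => //; exact: ideal_seq_head.
Qed.

Lemma quot_length_exp_seq s p D n : quot_length_le setT (ideal_of_seq (s ++ p)) n ->
  quot_length_le setT (ideal_of_seq ([seq z ^+ D | z <- s] ++ p)) (D ^ size s * n).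
Proof.
elim: s p => [|z s IHs] p /=; first by rewrite mul1n.
rewrite -ideal_seq_cat_cons => /IHs; rewrite ideal_seq_cat_cons => /(@quot_length_exp _ _ D).
by rewrite expnS mulnA.
Qed.

Lemma quot_length_m : quot_length_le setT m 1.
Proof.
apply: (@quot_length_le1 _ _ _ 1) => // [x _|r].
  by exists x; rewrite mulr1 subrr; exact: ideal0.
rewrite mulr1; have [mr|/local_unit[y yr]] := pselect (m r); [by left|right].
by exists y; rewrite yr subrr; exact: ideal0.
Qed.

Lemma seq_expr_mem A s : is_ideal A -> (forall x, x \in s -> exists n, A (x ^+ n)) ->
  exists n, forall x, x \in s -> A (x ^+ n).
Proof.
move=> idA; elim: s => [|x s IHs] sA; first by exists 0%N.
have [|n nA] := IHs; first by move=> y ys; apply: sA; rewrite inE ys orbT.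
have [n' An'] := sA x (mem_head _ _).
exists (n + n')%N => y; rewrite exprD inE => /predU1P[->|/nA]; first exact: idealMl.
by move=> Ay; exact: idealMr.
Qed.

Lemma mrad_quot_length A : is_ideal A -> mrad A -> exists n, quot_length_le setT A n.
Proof.
move=> idA radA; have [ms em] := noethR m_ideal.
have [|n nA] := @seq_expr_mem A ms idA.
  by move=> x xms; apply: radA; rewrite em; exact: mem_ideal_seq.
exists (n ^ size ms * 1)%N.
have len := @quot_length_exp_seq ms [::] n 1; rewrite !cats0 -em in len.
apply: quot_length_sub (len quot_length_m) => //.
by apply: ideal_seq_min => // _ /mapP[x /nA ? ->].
Qed.

(** If the c-th powers of [zs] lie in [I], then the (c D)-th powers lie in I^D, and they generate an
    ideal of colength at most (c D)^(size zs) times the bound for (zs). *)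
Lemma quot_length_power_bound I zs : is_ideal I -> mrad I -> sub_m zs ->
  mrad (ideal_of_seq zs) ->
  exists C, forall D, quot_length_le setT (ideal_exp I D) (C * D ^ size zs).
Proof.
move=> idI radI mz radz; have [|c cI] := @seq_expr_mem I zs idI.
  by move=> x /mz /radI.
have [n len] := mrad_quot_length (ideal_seq_ideal zs) radz.
exists (c ^ size zs * n)%N => D.
have := @quot_length_exp_seq zs [::] (c * D) n; rewrite !cats0 => /(_ len).
rewrite expnMn mulnAC; apply: quot_length_sub => //.
apply: ideal_seq_min => // _ /mapP[x /cI cx ->]; rewrite exprM.
exact: ideal_expX.
Qed.

End Length.

(** * Reductions *)

Section Reductions.
Variable I : set R.
Hypotheses (idI : is_ideal I) (radI : mrad I) (Im : I `<=` m).

Lemma sub_reduction H n : is_ideal H -> H `<=` I ->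
  ideal_exp I n.+1 `<=` ideal_mul H (ideal_exp I n) -> is_reduction H I.
Proof.
move=> idH HI sub; split=> //; exists n; rewrite eqEsubset; split=> //.
by rewrite ideal_expS; exact: ideal_mulS.
Qed.

Lemma reduction_nakayama H n : is_ideal H -> H `<=` I ->
  ideal_exp I n.+1 `<=` ideal_add (ideal_mul H (ideal_exp I n))
                                  (ideal_mul m (ideal_exp I n.+1)) ->
  is_reduction H I.
Proof. by move=> idH HI /nakayama sub; apply: (@sub_reduction H n) => //; exact: sub. Qed.

Lemma reduction_mrad H : is_reduction H I -> mrad H.
Proof.
move=> [idH HI [n eH]] x /radI[t It]; exists (t * n.+1)%N.
rewrite exprM; have := ideal_expX n.+1 It; rewrite eH.
by apply: ideal_mul_subl.
Qed.

(** The degree n part of the ideal of the Rees algebra of [I] generated by [H] in degree 1, hence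
    zero in degree 0. Congruence modulo it is therefore compatible with products. *)
Definition mul_pred (H : set R) n : set R :=
  if n is n'.+1 then ideal_mul H (ideal_exp I n') else [set 0].

Lemma mul_exp_mem H n n' x y : ideal_mul H (ideal_exp I n) x -> ideal_exp I n' y ->
  ideal_mul H (ideal_exp I (n + n')) (x * y).
Proof.
move=> Hx Iy; suff : ideal_mul H (ideal_exp I n) `<=`
    colon (ideal_mul H (ideal_exp I (n + n'))) y by exact.
apply: ideal_mul_min => [|u v Hu Iv]; first exact: colon_ideal.
by rewrite /colon /= -mulrA; apply: mem_ideal_mul => //; exact: ideal_expD_mem.
Qed.

Lemma mul_exp_memr H n n' x y : ideal_mul H (ideal_exp I n) x -> ideal_exp I n' y ->
  ideal_mul H (ideal_exp I (n' + n)) (y * x).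
Proof. by rewrite addnC mulrC; exact: mul_exp_mem. Qed.

Definition pow_cong H n x y :=
  [/\ ideal_exp I n x, ideal_exp I n y & mul_pred H n (x - y)].

Lemma pow_congM H n n' x y x' y' : pow_cong H n x y -> pow_cong H n' x' y' ->
  pow_cong H (n + n') (x * x') (y * y').
Proof.
move=> [Ix Iy xy] [Ix' Iy' xy']; split; try exact: ideal_expD_mem.
have -> : x * x' - y * y' = (x - y) * x' + y * (x' - y') by ring.
case: n n' Ix Iy xy Ix' Iy' xy' => [|n] [|n'] /= Ix Iy xy Ix' Iy' xy'.
- by rewrite xy xy' mul0r mulr0 addr0.
- rewrite xy mul0r add0r; exact: (@mul_exp_memr H n' 0 _ y xy').
- by rewrite xy' mulr0 addr0; exact: (@mul_exp_mem H n 0 _ x' xy).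
- apply: idealD => //; first exact: mul_exp_mem.
  by rewrite -addSnnS; exact: mul_exp_memr.
Qed.

Lemma pow_cong_prod H (T : finType) (f g : T -> R) (e : T -> nat) : is_ideal H ->
  (forall i, I (f i)) -> (forall i, I (g i)) -> (forall i, H (f i - g i)) ->
  pow_cong H (\sum_i e i) (\prod_i f i ^+ e i) (\prod_i g i ^+ e i).
Proof.
move=> idH If Ig Hfg.
have cong1 : pow_cong H 0 1 1 by split=> //; rewrite /= subrr.
elim/big_rec3: _ => // i x y n _ IHn; apply: pow_congM => //.
elim: (e i) => [|n' IHn'] //; rewrite !exprS -add1n; apply: pow_congM => //.
split; rewrite ?ideal_exp1 // -(mulr1 (_ - _)).
exact: mem_ideal_mul.
Qed.

Lemma meval_homog n (q : {mpoly R[n]}) D (c : R) (v : 'I_n -> R) :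
  (forall u, u \in msupp q -> mdeg u = D) ->
  q.@[fun i => c * v i] = c ^+ D * q.@[v].
Proof.
move=> degq; rewrite !mevalE big_distrr /= [LHS]big_seq [RHS]big_seq.
apply: eq_bigr => u /degq <-; rewrite mulrCA; congr (_ * _).
under eq_bigr do rewrite exprMn.
by rewrite big_split /= prodrXr -mdegE.
Qed.

Lemma pow_cong_meval H n (q : {mpoly R[n]}) D (f g : 'I_n -> R) : is_ideal H ->
  (forall u, u \in msupp q -> mdeg u = D.+1) ->
  (forall i, I (f i)) -> (forall i, I (g i)) -> (forall i, H (f i - g i)) ->
  ideal_mul H (ideal_exp I D) (q.@[f] - q.@[g]).
Proof.
move=> idH degq If Ig Hfg; rewrite !mevalE -sumrB big_seq; apply: ideal_bigsum => // u uq.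
rewrite -mulrBr; apply: idealMl => //.
have [_ _] := pow_cong_prod u idH If Ig Hfg.
by rewrite -mdegE (degq _ uq).
Qed.

(* A homogeneous relation among the generators of a reduction lets one drop a
   generator, after a linear change such that its last pure power has a unit
   coefficient. *)
Lemma reduction_drop n (h : 'I_n.+1 -> R) (q : {mpoly R[n.+1]}) D :
  is_reduction (ispan h) I -> (forall u, u \in msupp q -> mdeg u = D) ->
  map_mpoly res q != 0 -> ideal_mul m (ideal_exp I D) q.@[h] ->
  exists2 h' : 'I_n -> R, ispan h' `<=` ispan h & is_reduction (ispan h') I.
Proof.
move=> [_ HI [N eN]] degq /(mpoly_nonvanishing k_infinite)[v qv] qh.
have [c cv] := choice (fun i => res_lift (v i)).
have mid := m_ideal.
have Ih i : I (h i) by apply: HI; exact: ispan_mem.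
have {}qv : res q.@[c] != 0.
  by rewrite -meval_res (_ : (fun i => _) = v) //; apply/funext.
case: D degq qh => [|D] degq qh.
  have qconst : q.@[h] = q.@[c].
    rewrite !mevalE big_seq [RHS]big_seq; apply: eq_bigr => u /degq /eqP.
    by rewrite mdeg_eq0 => /eqP ->; congr (_ * _); apply: eq_bigr => i _; rewrite mnm0E.
  case/eqP: qv; apply/resE; rewrite -qconst.
  by apply: (ideal_mul_subl mid qh).
have [i0 ci0] : exists i0, res (c i0) != 0.
  apply/not_existsP => c0; case/eqP: qv; apply/resE; rewrite mevalE big_seq.
  apply: ideal_bigsum => // u uq; apply: idealMl => //.
  have [i ui] : exists i, u i != 0%N.
    apply/not_existsP => u0; have := degq u uq; rewrite mdegE big1 // => i _.
    by apply/eqP; have /negP := u0 i; rewrite negbK.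
  rewrite (bigD1 i) //=; apply: idealMr => //; rewrite -(prednK (n := u i)) ?lt0n //.
  rewrite exprS; apply: idealMr => //; apply/resE/eqP.
  by have /negP := c0 i; rewrite negbK.
(* Modulo [H'] the vector [c i0 * h i] is [h i0 * c i], so homogeneity turns the relation into a
   power of [h i0] times the unit [q.@[c]]. As [f i0] is 0, [H'] has one generator less. *)
pose f i := c i0 * h i - c i * h i0; pose H' := ispan f.
have idH' : is_ideal H' by exact: ispan_ideal.
have fh i : ispan h (f i).
  by apply: idealB => //; apply: idealMl => //; exact: ispan_mem.
have H'H : H' `<=` ispan h by exact: ispan_min.
have H'I : H' `<=` I by exact: subset_trans HI.
pose t := h i0; have It : I t by exact: Ih.
have tD : exists2 p, ideal_mul H' (ideal_exp I D) p &
    ideal_mul m (ideal_exp I D.+1) (t ^+ D.+1 - p).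
  have [y yq] := res_unit qv; have Ic i : I (t * c i) by exact: idealMr.
  have Ich i : I (c i0 * h i) by exact: idealMl.
  have Hf i : H' (c i0 * h i - t * c i) by rewrite [t * _]mulrC; exact: ispan_mem.
  have := pow_cong_meval idH' degq Ich Ic Hf; rewrite !(meval_homog _ _ degq) => Hq.
  exists (y * (t ^+ D.+1 * q.@[c] - c i0 ^+ D.+1 * q.@[h])).
    by apply: idealMl => //; rewrite -opprB; exact: idealN.
  have -> : t ^+ D.+1 - y * (t ^+ D.+1 * q.@[c] - c i0 ^+ D.+1 * q.@[h]) =
      t ^+ D.+1 * (1 - y * q.@[c]) + y * c i0 ^+ D.+1 * q.@[h] by ring.
  by rewrite yq subrr mulr0 add0r; exact: idealMl.
have stepH x b : ispan h x -> ideal_exp I N b -> exists y z,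
    [/\ ideal_mul H' (ideal_exp I N) y, ideal_exp I N z & x * b = y + t * z].
  move=> /ispanP[r ->] Ib; have [y yc] := res_unit ci0.
  exists ((\sum_i r i * (y * f i)) * b), ((\sum_i r i * (y * c i)) * b).
  split; [|exact: idealMl|].
    apply: mem_ideal_mul => //; apply: ideal_bigsum => // i _.
    by do 2!apply: idealMl => //; exact: ispan_mem.
  have -> : \sum_i r i * h i = \sum_i r i * (y * f i) + t * \sum_i r i * (y * c i).
    rewrite mulr_sumr -big_split /=; apply: eq_bigr => i _.
    have -> : r i * h i = r i * (y * c i0) * h i by rewrite yc mulr1.
    by rewrite /f /t; ring.
  ring.
(* Iterating [stepH] puts I^(N+j+1) inside H' I^(N+j) + t^(j+1) I^N. At j = D the power of [t] is
   replaced by means of [tD], with an error in m I^(N+D+1) that Nakayama removes. *)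
have powers j x : ideal_exp I (N + j.+1) x -> exists y z,
    [/\ ideal_mul H' (ideal_exp I (N + j)) y, ideal_exp I N z & x = y + t ^+ j.+1 * z].
  pose S n' := [set x | exists y z, [/\ ideal_mul H' (ideal_exp I (N + n')) y,
    ideal_exp I N z & x = y + t ^+ n'.+1 * z]].
  have idS n' : is_ideal (S n').
    split=> [|_ _ [y [z [Hy Iz ->]]] [y' [z' [Hy' Iz' ->]]]|r _ [y [z [Hy Iz ->]]]].
    - by exists 0, 0; rewrite mulr0 addr0; split=> //; exact: ideal0.
    - exists (y + y'), (z + z'); split; [exact: idealD|exact: idealD|].
      by rewrite mulrDr addrACA.
    - exists (r * y), (r * z); split; [exact: idealMl|exact: idealMl|].
      by rewrite mulrDr mulrCA.
  move: x; elim: j => [|j IHj].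
    rewrite addn1 eN; apply: (ideal_mul_min (idS 0%N)) => x b Hx Ib.
    by rewrite /S addn0 expr1; exact: stepH.
  rewrite addnS ideal_expS; apply: (ideal_mul_min (idS j.+1)) => u x Iu.
  move=> /IHj[y [z [Hy Iz ->]]].
  have : ideal_mul (ispan h) (ideal_exp I N) (u * z).
    by rewrite -eN ideal_expS; exact: mem_ideal_mul.
  have idS0 := idS 0%N.
  have : ideal_mul (ispan h) (ideal_exp I N) `<=` S 0%N.
    by apply: ideal_mul_min => // x' b Hx Ib; rewrite /S addn0 expr1; exact: stepH.
  move=> /[apply] -[y' [z' [Hy' Iz' e]]].
  exists (u * y + t ^+ j.+1 * y'), z'; split => //.
    apply: idealD => //.
      by rewrite addnS -add1n; apply: mul_exp_memr => //; rewrite ideal_exp1.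
    rewrite addn0 in Hy'; rewrite addnC.
    by apply: mul_exp_memr => //; exact: ideal_expX.
  rewrite mulrDr [u * (_ * z)]mulrCA e mulrDr addrA; congr (_ + _).
  by rewrite mulrA -exprSr.
exists (fun i => f (lift i0 i)); first by apply: ispan_min => // i; exact: fh.
have -> : ispan (fun i => f (lift i0 i)) = H'.
  rewrite eqEsubset; split; apply: ispan_min => // i; first exact: ispan_mem.
  case: (unliftP i0 i) => [j|] ->; first exact: (@ispan_mem _ _ (fun j => f (lift i0 j))).
  by rewrite /f mulrC subrr; exact: ideal0.
apply: (@reduction_nakayama _ (N + D)) => // x.
rewrite -addnS => /powers[y [z [Hy Iz ->]]].
have [p Hp mp] := tD.
exists (y + p * z); last first.
  exists ((t ^+ D.+1 - p) * z); last by ring.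
  by rewrite addnC; exact: mul_exp_mem.
by apply: idealD => //; rewrite addnC; exact: mul_exp_mem.
Qed.

Lemma reduction_drop_linear n (h e : 'I_n -> R) i : is_reduction (ispan h) I ->
  res (e i) != 0 -> ideal_mul m I (\sum_j e j * h j) ->
  exists2 h' : 'I_n.-1 -> R, ispan h' `<=` ispan h & is_reduction (ispan h') I.
Proof.
case: n h e i => [|n] h e i redh ei mI; first by case: i ei.
pose q : {mpoly R[n.+1]} := \sum_j e j *: 'X_j.
apply: (reduction_drop (q := q) (D := 1%N)) => //.
- have /dhomogP qhom : q \is 1.-homog.
    by apply: rpred_sum => j _; apply: rpredZ; rewrite dhomogX /= mdeg1.
  by move=> u /qhom.
- apply: contraNneq ei => /(congr1 (fun g => g@_U_(i))).
  rewrite mcoeff_map_mpoly mcoeff0 raddf_sum /= (bigD1 i) //= big1 ?addr0 => [|j ji].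
    by rewrite mcoeffZ mcoeffX eqxx mulr1 => ->.
  rewrite mcoeffZ mcoeffX; case: eqP => [/mnmP/(_ j)|_]; last by rewrite mulr0.
  by rewrite !mnm1E eqxx eq_sym (negPf ji).
rewrite ideal_exp1 // (_ : q.@[h] = \sum_j e j * h j) //.
by rewrite (raddf_sum (meval h)) /=; apply: eq_bigr => j _; rewrite mevalZ mevalXU.
Qed.

Variable zs : seq R.
Hypotheses (mz : sub_m zs) (radz : mrad (ideal_of_seq zs)).

(* The box monomials in the h_i of degree less than D = n e are too many to be
   independent modulo I^D, whose colength grows like D^(size zs). *)
Lemma homog_relation n (h : 'I_n -> R) : (size zs < n)%N -> (forall i, I (h i)) ->
  exists D (q : {mpoly R[n]}), [/\ forall u, u \in msupp q -> mdeg u = D,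
    map_mpoly res q != 0 & ideal_exp I D.+1 q.@[h]].
Proof.
move=> ltzn Ih; have [C lenC] := quot_length_power_bound idI radI mz radz.
(* This choice gives C D^(size zs) = C n^(size zs) e^(size zs) < e^(size zs + 1) <= e^n, the number
   of box monomials, all of degree at most n (e - 1) < D. *)
pose e := (C * n ^ size zs).+1; pose D := (n * e)%N.
pose mon (u : 'X_{1..n}) := \prod_(i < n) h i ^+ u i.
have Imon u : ideal_exp I (mdeg u) (mon u) by rewrite mdegE; exact: ideal_exp_prod.
(* In order of decreasing degree, a monomial dependent on earlier ones modulo I^D is expressed by
   monomials of at least its own degree. Those of larger degree, and I^D, go into the next power of
   [I]. *)
pose ord := fun u v : 'X_{1..n} => (mdeg v <= mdeg u)%N.
pose us := sort ord [seq [multinom (f i : nat) | i < n] | f : {ffun 'I_n -> 'I_e}].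
have size_us : size us = (e ^ n)%N.
  by rewrite size_sort size_map -cardE card_ffun !card_ord.
have uniq_us : uniq us.
  rewrite sort_uniq map_inj_uniq ?enum_uniq // => f g /mnmP fg; apply/ffunP => i.
  by apply: val_inj; have := fg i; rewrite !mnmE.
have deg_us u : u \in us -> (mdeg u < D)%N.
  rewrite mem_sort => /mapP[f _ ->]; rewrite mdegE /D.
  have n0 : (0 < n)%N by exact: leq_ltn_trans ltzn.
  apply: (@leq_ltn_trans (n * (C * n ^ size zs))).
    rewrite -[X in (_ <= X * _)%N]card_ord -sum_nat_const; apply: leq_sum => i _.
    by rewrite mnmE -ltnS; exact: ltn_ord.
  by rewrite ltn_pmul2l.
have sorted_us : sorted ord us.
  by apply: sort_sorted => u v; exact: leq_total.
pose N j := ideal_add (ideal_of_seq [seq mon u | u <- take j us]) (ideal_exp I D).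
have idN j : is_ideal (N j) by exact: ideal_add_ideal.
have [j jlt jN] : exists2 j, (j < size us)%N & N j.+1 `<=` N j.
  apply: contrapT => noj.
  have : (size us <= C * D ^ size zs)%N.
    apply: (lenC D N) => [i il|i il]; first by split=> //; exact: sub_ideal_addr.
    split=> [x|sub]; last by apply: noj; exists i.
    move=> [y Hy [z Iz <-]]; exists y; last by exists z.
    move: Hy; apply: ideal_seq_sub => w /mapP[u uin ->]; apply: map_f.
    by move: uin; rewrite (take_nth 0%MM) // mem_rcons inE orbC => ->.
  rewrite size_us /D expnMn mulnA leqNgt => /negP; apply.
  apply: leq_trans (leq_pexp2l (ltn0Sn _) ltzn).
  by rewrite expnS ltn_pmul2r ?expn_gt0.
pose y := nth 0%MM us j; have yus : y \in us by exact: mem_nth.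
have [x + [t It exy]] : N j (mon y).
  apply: jN; apply: sub_ideal_addl => //; apply: mem_ideal_seq; apply: map_f.
  by rewrite (take_nth 0%MM) // mem_rcons mem_head.
rewrite ispan_nth => /ispanP[r ex].
have sztk : size [seq mon u | u <- take j us] = j by rewrite size_map size_take jlt.
rewrite {}sztk in r ex.
pose w (i : 'I_j) := nth 0%MM us i.
have lt_us (i : 'I_j) : (i < size us)%N by exact: ltn_trans jlt.
have {}ex : x = \sum_i r i * mon (w i).
  rewrite ex; apply: eq_bigr => i _.
  by rewrite (nth_map 0%MM) ?size_take ?jlt // nth_take.
have wdeg i : (mdeg y <= mdeg (w i))%N.
  have trans : transitive ord by move=> u v v' uv vv'; exact: leq_trans uv.
  by apply: (sorted_ltn_nth trans 0%MM sorted_us) => //; rewrite inE.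
have wy i : w i != y by rewrite nth_uniq // ltn_eqF.
pose q : {mpoly R[n]} := 'X_[y] - \sum_(i < j | mdeg (w i) == mdeg y) r i *: 'X_[w i].
exists (mdeg y), q; split.
- have /dhomogP qhom : q \is (mdeg y).-homog.
    apply: rpredB; first by rewrite dhomogX.
    by apply: rpred_sum => i /eqP <-; apply: rpredZ; rewrite dhomogX.
  by move=> u /qhom.
- apply/eqP => /(congr1 (fun g => g@_y)).
  rewrite mcoeff_map_mpoly mcoeff0 mcoeffB raddf_sum /= mcoeffX eqxx big1 => [|i _].
    by rewrite subr0 rmorph1 => /eqP; rewrite oner_eq0.
  by rewrite mcoeffZ mcoeffX (negPf (wy i)) mulr0.
have -> : q.@[h] = t + \sum_(i < j | mdeg (w i) != mdeg y) r i * mon (w i).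
  rewrite mevalB mevalX -/(mon y) -exy ex (bigID (fun i => mdeg (w i) == mdeg y)) /=.
  have -> : (\sum_(i < j | mdeg (w i) == mdeg y) r i *: 'X_[w i]).@[h] =
      \sum_(i < j | mdeg (w i) == mdeg y) r i * mon (w i).
    by rewrite (raddf_sum (meval h)) /=; apply: eq_bigr => i _; rewrite mevalZ mevalX.
  ring.
apply: idealD => //; first by apply: ideal_exp_le It; exact: deg_us.
apply: ideal_bigsum => // i; rewrite neq_ltn ltnNge wdeg /= => lt_yw.
by apply: idealMl => //; exact: (ideal_exp_le lt_yw (Imon (w i))).
Qed.

Lemma ispan_widen n d (h : 'I_n -> R) : (n <= d)%N ->
  exists h' : 'I_d -> R, ispan h' = ispan h.
Proof.
move=> le_nd; exists (fun i => if insub (val i) is Some j then h j else 0).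
rewrite eqEsubset; split; apply: ispan_min => // i.
  by case: insubP => [j _ _|_]; [exact: ispan_mem|exact: ideal0].
have := @ispan_mem _ _ (fun i' : 'I_d => if insub (val i') is Some j then h j else 0)
  (widen_ord le_nd i).
by rewrite /= valK.
Qed.

Lemma reduction_gens H : is_reduction H I ->
  exists2 h : 'I_(size zs) -> R, ispan h `<=` H & is_reduction (ispan h) I.
Proof.
move=> redH; have [idH HI _] := redH; have [hs eH] := noethR idH.
pose h (i : 'I_(size hs)) := hs`_i.
have {}eH : H = ispan h by rewrite eH ispan_nth.
rewrite eH in redH HI *; move: (size hs) h redH HI {eH} => n.
elim: n => [|n IHn] h redH HI.
  by have [h' eh'] := ispan_widen h (leq0n (size zs)); exists h'; rewrite eh'.
have [le_n|lt_n] := leqP n.+1 (size zs).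
  by have [h' eh'] := ispan_widen h le_n; exists h'; rewrite eh'.
have [|D [q [degq q0 qh]]] := homog_relation (h := h) lt_n.
  by move=> i; apply: HI; exact: ispan_mem.
have [|h' h'h redh'] := reduction_drop redH degq q0.
  by move: qh; rewrite ideal_expS; exact: ideal_mulS.
have [_ h'I _] := redh'.
have [g gh' redg] := IHn h' redh' h'I.
by exists g => //; exact: subset_trans h'h.
Qed.

Lemma minimal_reduction_gens H : minimal_reduction H I ->
  exists h : 'I_(size zs) -> R, H = ispan h.
Proof.
move=> [redH minH]; have [h hH redh] := reduction_gens redH.
by exists h; rewrite (minH _ redh hH).
Qed.

Lemma reduction_size n (h : 'I_n -> R) : reg [::] zs -> is_reduction (ispan h) I ->
  (size zs <= n)%N.
Proof.
move=> regz redh; have [_ hI _] := redh.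
have := @mrad_size zs regz mz (codom h) _ (reduction_mrad redh).
rewrite size_codom card_ord; apply=> _ /codomP[i ->].
by apply: Im; apply: hI; exact: ispan_mem.
Qed.

(* A smaller reduction would contain one generated by a matrix multiple M x of
   the generators x, with res M singular; a vector in the kernel then yields a
   linear relation modulo m I, hence a reduction with fewer generators. *)
Lemma reduction_minimal (x : 'I_(size zs) -> R) : reg [::] zs ->
  is_reduction (ispan x) I -> minimal_reduction (ispan x) I.
Proof.
move=> regz redx; split=> // J redJ Jx.
have [h hJ redh] := reduction_gens redJ.
suff xh : ispan x `<=` ispan h.
  by rewrite eqEsubset; split=> //; exact: subset_trans hJ.
have [_ xI _] := redx; have [_ hI _] := redh.
have step i : exists c : 'I_(size zs) -> R, h i = \sum_j c j * x j.
  by apply/ispanP; apply: Jx; apply: hJ; exact: ispan_mem.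
have [c cP] := choice step; pose M := \matrix_(i, j) c i j.
have hM : \col_i h i = M *m \col_j x j.
  by apply/colP => i; rewrite !mxE cP; apply: eq_bigr => j _; rewrite !mxE.
have [detM|detM] := eqVneq (res (\det M)) 0; last first.
  apply: ispan_min => // j; apply: (ideal_unit_cancel (ispan_ideal h) detM).
  have -> : \det M * x j = (\adj M *m \col_i h i) j 0.
    by rewrite hM mulmxA mul_adj_mx mul_scalar_mx !mxE.
  rewrite mxE; apply: ideal_bigsum => // i _; apply: idealMl => //.
  by rewrite mxE; exact: ispan_mem.
exfalso.
have /negP : ~~ row_free (map_mx res M).
  by rewrite row_free_unit unitmxE det_map_mx detM unitr0.
case; apply: inj_row_free => v vM; apply/rowP => i1; rewrite mxE.
apply/eqP; apply: contrapT => /negP vi1.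
have [e ev] := choice (fun i => res_lift (v 0 i)).
have [||g _ redg] := @reduction_drop_linear _ h e i1 redh; first by rewrite ev.
  have -> : \sum_i e i * h i = \sum_j (\sum_i e i * c i j) * x j.
    under eq_bigr do rewrite cP mulr_sumr.
    rewrite exchange_big; apply: eq_bigr => j _ /=; rewrite mulr_suml.
    by apply: eq_bigr => i _; rewrite mulrA.
  apply: ideal_bigsum => // j _; apply: mem_ideal_mul; last exact: (xI _ (@ispan_mem _ _ x j)).
  apply/resE; rewrite rmorph_sum; have := congr1 (fun u : 'rV_ _ => u 0 j) vM.
  rewrite !mxE => vMj; rewrite -[RHS]vMj; apply: eq_bigr => i _.
  by rewrite rmorphM ev !mxE.
have := reduction_size regz redg.
by rewrite leqNgt prednK ?leqnn //; exact: leq_ltn_trans (ltn_ord i1).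
Qed.

End Reductions.

(** * Stretched and j-stretched ideals *)

(** Any [w] outside [B] generates [A] modulo [B], as otherwise B + (w) is a strict intermediate
    ideal. If [y] in m did not kill [w], then B + (y w) would lie strictly between [B] and B + (w),
    because 1 - e y is a unit. *)
Lemma quot_length_le1_gen A B : is_ideal A -> is_ideal B -> B `<=` A ->
  quot_length_le A B 1 -> exists w, [/\ A w,
    forall x, A x -> exists e, B (x - e * w) & forall y, m y -> B (y * w)].
Proof.
move=> idA idB BA len.
have [AB|nAB] := pselect (A `<=` B).
  exists 0; split=> [|x /AB|y _]; first exact: ideal0.
    by exists 0; rewrite mulr0 subr0.
  by rewrite mulr0; exact: ideal0.
have [w Aw Bw] : exists2 w, A w & ~ B w.
  by apply: contrapT => H; apply: nAB => x Ax; apply: contrapT => Bx; apply: H; exists x.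
pose Bp y := [set x | exists e, B (x - e * y)].
have idBp y : is_ideal (Bp y).
  split=> [|u v [r Bu] [t Bv]|t u [r Bu]].
  - by exists 0; rewrite mul0r subr0; exact: ideal0.
  - by exists (r + t); rewrite mulrDl opprD addrACA; exact: idealD.
  - by exists (t * r); rewrite -mulrA -mulrBr; exact: idealMl.
have BBp y : B `<=` Bp y by move=> x Bx; exists 0; rewrite mul0r subr0.
have Bpy y : Bp y y by exists 1; rewrite mul1r subrr; exact: ideal0.
have BpA y C : is_ideal C -> B `<=` C -> C y -> Bp y `<=` C.
  by move=> idC BC Cy x [e /BC]; move/idealBr; apply => //; exact: idealMl.
have chain (N1 N2 : set R) : is_ideal N1 -> is_ideal N2 -> B `<=` N1 -> N1 `<=` N2 ->
    N2 `<=` A -> ~ N1 `<=` B -> ~ N2 `<=` N1 -> False.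
  move=> id1 id2 BN1 N12 N2A N1B N21.
  pose N i := nth B [:: B; N1; N2] i.
  have NAB i : (i <= 2)%N -> [/\ is_ideal (N i), B `<=` N i & N i `<=` A].
    case: i => [|[|[|//]]] _; split=> //; first exact: subset_trans N2A.
    exact: subset_trans N12.
  have Nlt i : (i < 2)%N -> N i `<` N i.+1 by case: i => [|[|//]].
  by have := len N 2%N NAB Nlt.
have wA : A `<=` Bp w.
  apply: contrapT => nA; apply: (chain (Bp w) A) => //; first exact: BpA.
  by move=> sub; apply: Bw; exact: sub.
exists w; split=> // y my; apply: contrapT => Byw.
have yww : Bp w (y * w) by exact: idealMl.
apply: (chain (Bp (y * w)) (Bp w)) => //.
- exact: BpA.
- exact: BpA.
- by move=> sub; apply: Byw; exact: sub.
move=> /(_ _ (Bpy w))[e Be]; apply: Bw.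
have u1 : res (1 - e * y) != 0.
  by rewrite rmorphB rmorphM (resE y).1 // mulr0 subr0 rmorph1 oner_eq0.
by apply: (ideal_unit_cancel idB u1); rewrite mulrBl mul1r -mulrA.
Qed.

Section Main.
Variables (s : nat) (t : s.-tuple R) (I : set R) (zs : seq R).
Hypotheses (It : I = ispan (tnth t)) (idI : is_ideal I) (radI : mrad I) (Im : I `<=` m).
Hypotheses (mz : sub_m zs) (regz : reg [::] zs) (radz : mrad (ideal_of_seq zs)).
Hypothesis zs0 : (0 < size zs)%N.

Notation d := (size zs).
Notation x_ L := (lincomb (tnth t) L).
Notation J_ L := (ispan (lincomb (tnth t) L)).

Lemma ideal_exp2 : ideal_exp I 2 = ideal_mul I I.
Proof. by rewrite ideal_expS ideal_exp1. Qed.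

Lemma I_proper : ~ I 1.
Proof. by move=> /Im; exact: m_proper. Qed.

(** [I] is a reduction of itself, so some d of its elements generate a reduction. The equality for
    its exponent n is spread by [generic_cover], with I^n for [B] and 0 for [C]. *)
Lemma generic_reduction :
  generic (fun L : 'M[R]_(d, s) => is_reduction (J_ L) I).
Proof.
have redI : is_reduction I I by split=> //; exists 0%N.
have [h hI redh] := reduction_gens idI radI Im mz radz redI.
have [L0 eL0] := lincomb_onto It (fun i => hI _ (@ispan_mem _ _ h i)).
have [_ _ [n en]] := redh; rewrite -{}eL0 in en.
have [|] := @generic_cover d s (tnth t) I It (ideal_exp I n) (ideal_of_seq [::])
  (ideal_exp_ideal _ _) (ideal_seq_ideal _) L0.
  by rewrite -ideal_expS en; exact: sub_ideal_addl.
move=> q q0 qP; exists q => // L /qP sub.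
apply: (@sub_reduction I _ n) => //; first exact: (genJ_sub It).
apply: subset_trans sub _; apply: ideal_add_min => //.
by rewrite ideal_seq_nil => _ ->; exact: ideal0.
Qed.

Lemma reduction_reg n (x : n.-tuple R) : (n <= d)%N -> is_reduction (ideal_of_seq x) I ->
  reg [::] x.
Proof.
move=> nd redx; have [_ xI _] := redx; apply: (@sop_reg zs) => //.
- by move=> y yx; apply: Im; apply: xI; exact: mem_ideal_seq.
- by rewrite size_tuple.
exact: reduction_mrad redx.
Qed.

Lemma reg_syzygy_tuple n (x : n.-tuple R) (r : 'I_n -> R) : sub_m x -> reg [::] x ->
  \sum_i r i * tnth x i = 0 -> forall i, ideal_of_seq x (r i).
Proof.
move=> mx regx sum0 i.
pose r' j := if insub j is Some j' then r j' else 0.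
have r'E (j : 'I_n) : r' j = r j by rewrite /r' valK.
have := @reg_syzygy [::] x r' mx regx; rewrite cats0 size_tuple => /(_ _ i (ltn_ord i)).
rewrite r'E; apply; rewrite (_ : \sum_(j < n) _ = 0); first exact: ideal0.
by rewrite -[RHS]sum0; apply: eq_bigr => j _; rewrite r'E (tnth_nth 0).
Qed.

(** A combination of the generators lying in I^2 lies in H I, hence can also be written with
    coefficients in [I]. The two coefficient tuples differ by a syzygy of a regular sequence, whose
    entries lie in [H]. *)
Lemma minimal_reduction_indep H : minimal_reduction H I ->
  ideal_exp I 2 `&` H = ideal_mul H I ->
  exists L0 : 'M[R]_(d, s), H = J_ L0 /\ indep_mod (tnth t) I (ideal_exp I 2) L0.
Proof.
move=> minH HI; have [redH _] := minH.
have [h eH] := minimal_reduction_gens idI radI Im mz radz minH.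
have [_ HsubI _] := redH.
have hI i : I (h i) by apply: HsubI; rewrite eH; exact: ispan_mem.
have [L0 eL0] := lincomb_onto It hI; exists L0; rewrite eL0; split=> // r Ir i.
rewrite eL0 in Ir.
have : ideal_mul H I (\sum_i r i * h i).
  by rewrite -HI; split=> //; rewrite eH; apply/ispanP; exists r.
rewrite {1}eH => /(ispan_mulP _ _ idI)[b [Ib e]].
have eHt : H = ideal_of_seq (mktuple h) by rewrite ispan_mktuple.
have sum0 : \sum_i (r i - b i) * tnth (mktuple h) i = 0.
  under eq_bigr do rewrite tnth_mktuple mulrBl.
  by rewrite sumrB e -sumrB big1 // => j _; rewrite mulrC subrr.
have mh : sub_m (mktuple h).
  by move=> y /mapP[j _ ->]; exact: Im (hI j).
have regh : reg [::] (mktuple h) by apply: reduction_reg; rewrite -?eHt.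
apply: (@idealBr _ (b i)) => //; apply: HsubI; rewrite eHt.
exact: (reg_syzygy_tuple mh regh sum0 i).
Qed.

Lemma indep_genJ_mul (L : 'M[R]_(d, s)) b :
  indep_mod (tnth t) I (ideal_exp I 2) L -> J_ L b -> ideal_exp I 2 b ->
  ideal_mul (J_ L) I b.
Proof.
move=> indepL /ispanP[r ->] /indepL Ir; apply: ideal_bigsum => // i _.
by rewrite mulrC; apply: mem_ideal_mul => //; exact: ispan_mem.
Qed.

Definition jK (L : 'M[R]_(d, s)) : set R :=
  saturation (ideal_of_seq (take d.-1 (mktuple (x_ L)))) I.

Definition j_stretched_at (L : 'M[R]_(d, s)) : Prop :=
  let Ibar : set (quot_ring (jK L)) := quot_map (jK L) @` I in
  quot_length_le (ideal_exp Ibar 2)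
   (ideal_add (ideal_mul (ideal_of_seq [:: quot_map (jK L) (mktuple (x_ L))`_d.-1]) Ibar)
      (ideal_exp Ibar 3)) 1.

Lemma j_stretched_generic : j_stretched res d I t <-> generic j_stretched_at.
Proof. exact: (@for_generalP d s (tnth t) t). Qed.

Lemma j_stretched_atE L : j_stretched_at L =
  quot_length_le (quot_map (jK L) @` ideal_exp I 2) (quot_map (jK L) @` ideal_add
    (ideal_mul (ideal_of_seq [:: (mktuple (x_ L))`_d.-1]) I) (ideal_exp I 3)) 1.
Proof.
have surj := @quot_map_surj R (jK L).
have seqE := image_ideal_seq surj [:: (mktuple (x_ L))`_d.-1]; rewrite /= in seqE.
by rewrite /j_stretched_at !(image_ideal_exp surj) seqE (image_ideal_mul surj) image_ideal_add.
Qed.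

Lemma mktuple_last (L : 'M[R]_(d, s)) : mktuple (x_ L) =
  rcons (take d.-1 (mktuple (x_ L))) (mktuple (x_ L))`_d.-1 :> seq R.
Proof.
rewrite -take_nth ?size_tuple ?prednK //.
by rewrite take_oversize // size_tuple.
Qed.

Lemma genJ_lastP (L : 'M[R]_(d, s)) b : J_ L b -> exists r,
  ideal_of_seq (take d.-1 (mktuple (x_ L))) (b - r * (mktuple (x_ L))`_d.-1).
Proof.
rewrite -ispan_mktuple {1}mktuple_last -cats1 ideal_seq_cat_cons cats0.
by move=> /ideal_seq_consP.
Qed.

Lemma sub_jK L : ideal_of_seq (take d.-1 (mktuple (x_ L))) `<=` jK L.
Proof. by move=> b Jb; exists 1%N => // y _; exact: idealMr. Qed.

Notation qm L := (quot_map (jK L)).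

(** The first d - 1 combinations vanish in the quotient ring, so J(L) I is mapped into the product
    of the last one with the image of [I]; the generator [w] and its annihilation by m pass to the
    images. *)
Lemma colength_j_stretched (L : 'M[R]_(d, s)) :
  colength_le1 (tnth t) I I (ideal_exp I 3) L -> j_stretched_at L.
Proof.
rewrite j_stretched_atE => -[w []]; rewrite -ideal_exp2 => Iw wI mw.
set y := nth _ _ _; set B := ideal_add _ _.
have surj := @quot_map_surj R (jK L).
have idB : is_ideal B by exact: ideal_add_ideal.
have idfB : is_ideal (qm L @` B) by exact: image_ideal.
have f0 b : jK L b -> qm L b = 0.
  move=> Kb; rewrite -(rmorph0 (qm L)); apply/quot_mapP; rewrite subr0.
  exact: sub_ideal_gen.
have cofB x : cofactor_ideal (tnth t) I (ideal_exp I 3) L x -> (qm L @` B) (qm L x).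
  move=> [u + [v Iv <-]]; rewrite rmorphD => JIu; apply: idealD => //; last first.
    by exists v => //; exact: sub_ideal_addr.
  have idC := preimage_ideal (quot_map (jK L)) idfB.
  move: u JIu; apply: (ideal_mul_min idC) => b c /genJ_lastP[r Jb] Ic.
  exists (r * y * c).
    apply: sub_ideal_addl => //; apply: mem_ideal_mul => //.
    by apply: idealMl => //; exact: ideal_seq_head.
  rewrite !rmorphM; congr (_ * _); apply/eqP; rewrite eq_sym -subr_eq0 -rmorphM -rmorphB.
  by apply/eqP/f0/sub_jK.
apply: (@quot_length_le1 _ _ _ (qm L w)) => //.
  by move=> _ [x /wI[e /cofB Bx] <-]; exists (qm L e); rewrite -rmorphM -rmorphB.
move=> r; have [r' <-] := surj r; have [mr|/local_unit[z zr]] := pselect (m r').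
  by left; rewrite -rmorphM; apply: cofB; exact: mw.
right; exists (qm L z).
have -> : qm L z * (qm L r' * qm L w) = qm L (z * r' * w) by rewrite !rmorphM mulrA.
rewrite zr mul1r subrr.
exact: ideal0.
Qed.

(** As x_d lies in [I] and is regular modulo the others, the saturation is just (p). Chains stay
    strict in the quotient ring: the kernel meets I^2 inside J(L) cap I^2 = J(L) I, which lies in
    every term of the chain. *)
Lemma j_stretched_colength (L : 'M[R]_(d, s)) : reg [::] (mktuple (x_ L)) ->
  indep_mod (tnth t) I (ideal_exp I 2) L -> j_stretched_at L ->
  quot_length_le (ideal_exp I 2) (ideal_add (ideal_mul (J_ L) I) (ideal_exp I 3)) 1.
Proof.
rewrite j_stretched_atE {1}mktuple_last => /reg_rcons[_]; rewrite cats0.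
set y := nth _ _ _; set p := take _ _ => nzy indepL len.
have surj := @quot_map_surj R (jK L).
have JE : J_ L = ideal_of_seq (mktuple (x_ L)) by rewrite ispan_mktuple.
have yJ : J_ L y.
  by rewrite JE; apply: mem_ideal_seq; rewrite mem_nth // size_tuple prednK.
have Iy : I y by apply: (genJ_sub It) yJ.
have Kp : jK L `<=` ideal_of_seq p.
  move=> b [n _ /(_ _ (ideal_expX n Iy))].
  elim: n => [|n IHn]; first by rewrite expr0 mulr1.
  by rewrite exprSr mulrA => /nzy.
have idK : is_ideal (jK L).
  have -> : jK L = ideal_of_seq p by rewrite eqEsubset; split=> //; exact: sub_jK.
  exact: ideal_seq_ideal.
have pJ : ideal_of_seq p `<=` J_ L.
  by rewrite JE; apply: ideal_seq_sub => z /mem_take.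
move=> N l NAB Nlt; apply: (len (fun i => quot_map (jK L) @` N i)) => i il.
  have [idN BN NA] := NAB i il; split; [exact: image_ideal| |exact: image_subset].
  apply: image_subset; apply: subset_trans BN; apply: ideal_add_min.
  - exact: ideal_add_ideal.
  - apply: subset_trans (@sub_ideal_addl _ _ _ _) => //.
    by apply: ideal_mulS => //; apply: ideal_seq_min => // z; rewrite inE => /eqP ->.
  - exact: sub_ideal_addr.
have [Nle NN] := Nlt i il; split=> [|sub]; first exact: image_subset.
apply: NN => b Nb; have [] := sub (quot_map (jK L) b); first by exists b.
move=> c Nc /esym/quot_mapP; rewrite ideal_gen_id // => Kbc.
have [idN BN NA] := NAB i (ltnW il); have [_ _ NA'] := NAB i.+1 il.
apply: (@idealBr _ c) => //; apply: BN; apply: sub_ideal_addl => //.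
apply: (indep_genJ_mul indepL); first by apply: pJ; exact: Kp.
by apply: idealB => //; [exact: NA'|exact: NA].
Qed.

Lemma stretched_iff_j_stretched H0 : minimal_reduction H0 I ->
  ideal_exp I 2 `&` H0 = ideal_mul H0 I -> stretched I <-> j_stretched res d I t.
Proof.
move=> min0 H0I; rewrite j_stretched_generic; split=> [[H [minH HI len]]|genj].
  have [h eH] := minimal_reduction_gens idI radI Im mz radz minH.
  have [[_ HsubI _] _] := minH.
  have hI i : I (h i) by apply: HsubI; rewrite eH; exact: ispan_mem.
  have [L0 eL0] := lincomb_onto It hI.
  apply: generic_sub (@colength_j_stretched) _.
  apply: (@generic_colength_le1 d s (tnth t) I It I (ideal_exp I 3) idI _ L0) => //.
  rewrite HI eH -eL0 in len.
  have [|||w [Aw wA mw]] := quot_length_le1_gen _ _ _ len => //.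
  - exact: ideal_add_ideal.
  - apply: ideal_add_min => //; last exact: ideal_exp_le.
    by rewrite ideal_exp2; apply: ideal_mulS => //; exact: (genJ_sub It).
  by exists w; rewrite -ideal_exp2; split.
have [L1 [_ indep1]] := minimal_reduction_indep min0 H0I.
have genA := generic_indep It (ideal_exp_ideal I 2) (@subset_refl _ _) radI I_proper indep1.
(* Finitely many generic conditions hold together at some matrix; its ideal [J_ L] is the minimal
   reduction required by [stretched]. *)
have [L [[jL indepL] redL]] :=
  generic_ex (generic_and (generic_and genj genA) generic_reduction).
have regL : reg [::] (mktuple (x_ L)).
  by apply: reduction_reg => //; rewrite ispan_mktuple.
have JI2 : J_ L `&` ideal_exp I 2 = ideal_mul (J_ L) I.
  rewrite eqEsubset; split=> [b [Jb Ib]|]; first exact: indep_genJ_mul.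
  move=> b Jb; split; first by apply: ideal_mul_subl Jb.
  by rewrite ideal_exp2; move: Jb; apply: ideal_mulS => //; exact: (genJ_sub It).
exists (J_ L); split => //.
  exact: (reduction_minimal idI radI Im mz radz regz redL).
by rewrite JI2; exact: j_stretched_colength.
Qed.

End Main.
End LocalRing.

Theorem proposition5p5 (R : comNzRingType) (m : set R) (k : fieldType)
    (res : {rmorphism R -> k}) (d : nat) (I : set R) (s : nat) (a : s.-tuple R)
    (CM : cohen_macaulay_local m) (resP : is_residue_map m res)
    (equichar : equicharacteristic R k) (k_infinite : infinite_set [set: k])
    (dimR : has_krull_dim R d) (d_ge1 : (1 <= d)%N)
    (Iprimary : primary_to m I) (Igen : I = ideal_of_seq a)
    (HI : exists H : set R, minimal_reduction H I /\
            ideal_exp I 2 `&` H = ideal_mul H I) :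
  stretched I <-> j_stretched res d I a.
Proof.
have [noethR localR [n [dimn [[zs [regz zsm size_zs]] _]]]] := CM.
have eq_dn : n = d.
  have [[P chainP] maxP] := dimR; have [[Q chainQ] maxQ] := dimn.
  by apply/eqP; rewrite eqn_leq (maxP _ _ chainQ) (maxQ _ _ chainP).
have [H0 [minH0 H0I]] := HI; have [[idI _ _] radI] := Iprimary.
have Im : I `<=` m by move=> x Ix; rewrite -radI; exists 1%N.
have mradI : mrad m I by move=> x; rewrite -radI.
have It : I = ispan (tnth a) by rewrite Igen ispan_tuple.
have mzs : sub_m m zs by move=> z; exact: zsm.
have regzs := regular_sequence_reg regz.
rewrite eq_dn in size_zs.
have radzs := reg_mrad noethR localR resP dimR regzs mzs size_zs.
rewrite -size_zs in d_ge1 *.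
exact: (stretched_iff_j_stretched noethR localR resP k_infinite It idI mradI Im
  mzs regzs radzs d_ge1 minH0 H0I).
Qed.
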